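(* Let $\theta^*\in\mathbb{R}$ and $c>0$. Consider the Dirichlet process mixture model with uniform kernel $k(x\mid\theta)=(2c)^{-1}\mathbb{1}_{(\theta-c,\theta+c)}(x)$, base density $q_0$ equal to the uniform density on $(\theta^*-c,\theta^*+c)$, and prior $\pi$ on the concentration parameter satisfying A1, A2 and A3 with some $\rho\ge38$. Let $X_1,X_2,\dots$ be i.i.d. $\mathrm{Unif}(\theta^*-c,\theta^*+c)$, with joint law $P^{(\infty)}$. Then $\mathrm{pr}(K_n=1\mid X_{1:n})\to1$ in $P^{(\infty)}$-probability as $n\to\infty$.
   Context: Model: $\alpha\sim\pi$, $\tilde P\mid\alpha\sim\mathrm{DP}(\alpha,Q_0)$ with $Q_0$ having density $q_0$, $\theta_i\mid\tilde P$ i.i.d. $\tilde P$, $X_i\mid\theta_i\sim k(\cdot\mid\theta_i)$ independently. $K_n$ is the number of distinct values among $\theta_1,\dots,\theta_n$. With $\tau_s(n)$ the set of partitions of $\{1,\dots,n\}$ into $s$ nonempty blocks $A_1,\dots,A_s$, $a_j=|A_j|$, $\alpha^{(n)}=\alpha(\alpha+1)\cdots(\alpha+n-1)$, and $m(x_B)=\int\prod_{i\in B}k(x_i\mid\theta)q_0(\theta)d\theta$, the posterior is $\mathrm{pr}(K_n=s\mid X_{1:n})=W_s/\sum_{r=1}^nW_r$ with $W_s=\int_0^\infty\frac{\alpha^s}{\alpha^{(n)}}\pi(d\alpha)\sum_{A\in\tau_s(n)}\prod_j(a_j-1)!\,m(X_{A_j})$. (A1) $\pi$ has a Lebesgue density,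 also denoted $\pi$; (A2) there exist $\epsilon,\delta,\beta$ with $\frac1\delta\alpha^\beta\le\pi(\alpha)\le\delta\alpha^\beta$ for all $\alpha\in(0,\epsilon)$; (A3) there exist $D,\nu,\rho>0$ with $\int\alpha^s\pi(\alpha)d\alpha<D\rho^{-s}\Gamma(\nu+s+1)$ for every integer $s\ge1$. *)

(* Defs.v *)
From HB Require Import structures.
From mathcomp Require Import all_boot all_order all_algebra.
From mathcomp Require Import all_classical all_reals all_analysis.
Set Implicit Arguments. Unset Strict Implicit. Unset Printing Implicit Defensive.
Import Order.TTheory GRing.Theory Num.Theory.
Import numFieldNormedType.Exports.
Local Open Scope classical_set_scope.
Local Open Scope ring_scope.

Section DPM.
Variable R : realType.
Local Notation mu := (@lebesgue_measure R).

Definition posR : set R := `]0, +oo[%classic.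

Definition Gamma (z : R) : R :=
  Rintegral mu posR (fun t => t `^ (z - 1) * expR (- t)).

Definition rising (a : R) (n : nat) : R := \prod_(i < n) (a + i%:R).

Definition partitions_s (n s : nat) : {set {set {set 'I_n}}} :=
  [set P : {set {set 'I_n}} | finset.partition P [set: 'I_n] && (#|P| == s)%N].

Definition marg (k : R -> R -> R) (q0 : R -> R) (n : nat) (x : 'I_n -> R)
    (B : {set 'I_n}) : R :=
  Rintegral mu setT (fun th => (\prod_(i in B) k (x i) th) * q0 th).

Definition Wpost (k : R -> R -> R) (q0 : R -> R) (pi : R -> R) (n : nat)
    (x : 'I_n -> R) (s : nat) : R :=
  Rintegral mu posR (fun a => a ^+ s / rising a n * pi a) *
  \sum_(P in partitions_s n s)
     \prod_(A in P) (((#|A|.-1)`!)%:R * marg k q0 x A).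

Definition postK (k : R -> R -> R) (q0 : R -> R) (pi : R -> R) (n : nat)
    (x : 'I_n -> R) (s : nat) : R :=
  Wpost k q0 pi x s / \sum_(1 <= r < n.+1) Wpost k q0 pi x r.

Definition unif_kernel (c : R) (x th : R) : R :=
  if (th - c < x) && (x < th + c) then (2 * c)^-1 else 0.

Definition unif_dens (ths c : R) (th : R) : R :=
  if (ths - c < th) && (th < ths + c) then (2 * c)^-1 else 0.

Definition A1 (pi : R -> R) : Prop :=
  measurable_fun setT pi /\ (forall a, 0 < a -> 0 <= pi a) /\
  (\int[mu]_(a in posR) (pi a)%:E = 1)%E.

Definition A2 (pi : R -> R) : Prop :=
  exists eps delta beta : R, 0 < eps /\ 0 < delta /\
    forall a, 0 < a -> a < eps ->
      delta^-1 * a `^ beta <= pi a /\ pi a <= delta * a `^ beta.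

Definition A3_ge (rho0 : R) (pi : R -> R) : Prop :=
  exists D nu rho : R, 0 < D /\ 0 < nu /\ 0 < rho /\ rho0 <= rho /\
    forall s : nat, (1 <= s)%N ->
      (\int[mu]_(a in posR) (a ^+ s * pi a)%:E
        < (D * rho ^- s * Gamma (nu + s%:R + 1))%:E)%E.

End DPM.

(* mutual independence of a sequence of real random variables: for every n
   and Borel sets B_0..B_{n-1}, P(cap_{i<n} {X_i in B_i}) = prod_{i<n} P(X_i in B_i)
   (taking B_i = R for unused indices this covers every finite subfamily) *)
Definition mutually_independent d (Omega : measurableType d) (R : realType)
    (P : probability Omega R) (X : nat -> Omega -> R) : Prop :=
  forall (n : nat) (B : nat -> set R), (forall i, measurable (B i)) ->
    P (\bigcap_(i in `I_n) (X i @^-1` B i)) = (\prod_(i < n) P (X i @^-1` B i))%E.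

(* Main.v *)
Require Import Defs.
From HB Require Import structures.
From mathcomp Require Import all_boot all_order all_algebra.
From mathcomp Require Import all_classical all_reals all_analysis.
From mathcomp Require Import measurable_realfun.
From mathcomp Require Import lra ring zify.
Set Implicit Arguments. Unset Strict Implicit. Unset Printing Implicit Defensive.
Import Order.TTheory GRing.Theory Num.Theory.
Import numFieldNormedType.Exports.
Local Open Scope classical_set_scope.
Local Open Scope ring_scope.

(** With L_B in [0, 1] the fraction of ]ths - c, ths + c[ left to theta by the
    constraints |x_i - theta| < c, i in B, one has m(x_B) = (2c)^-|B| L_B, so that
    the factor (2c)^-n cancels in the posterior.  It remains to show that
    sum_(s >= 2) W_s / W_1 tends to 0 in probability.

    Denominator.  L_[n] < delta/n forces some X_i to lie within c delta/n of an end of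
    its range, which has probability at most delta.

    Numerator, in expectation.  By independence E prod_A L_A is a product, and
    E L_A <= 4/(|A|+1).  Summing (|A|-1)! / (|A|+1) over the set partitions into s
    blocks yields n!/s! times the s-fold convolution power of p(a) = 1/(a(a+1)) at n,
    which is at most s^3/n^2 since one part is at least n/s.  Hence the s-block sum is
    at most 4^s s^3 / (s! n) times (n-1)!, against (n-1)! L_[n] for one block.

    Prior.  I_s / I_1, with I_s the integral of alpha^s / alpha^(n) against the prior,
    is at most eta + r_n M_(s-1) for every eta in ]0, 1], where M_s is the s-th moment
    of the prior and, for fixed eta, r_n -> 0 because the harmonic series diverges.  Since
    M_s = O(s! / 19^s), the sum over s of these bounds converges. *)

(** * Sums over set partitions *)

(** Coefficient of z^n in the s-th power of the series of p(a) z^a over a >= 1; the sum starts at 1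
    because blocks are nonempty. *)
Fixpoint conv_pow (R : pzRingType) (p : nat -> R) (s n : nat) : R :=
  if s is s'.+1 then \sum_(1 <= a < n.+1) p a * conv_pow p s' (n - a)
  else (n == 0%N)%:R.

(** Extends [partitions_s] to subsets of any finite type, since the recursion passes from D to D
    minus a block. *)
Definition set_partitions (T : finType) (D : {set T}) (s : nat) : {set {set {set T}}} :=
  [set P | finset.partition P D && (#|P| == s)%N].

Section SetPartitions.
Variables (R : numFieldType) (T : finType).
Implicit Types (D A : {set T}) (P : {set {set T}}).

Lemma sum_by_card (f : nat -> R) D :
  \sum_(A : {set T} | A \subset D) f #|A| =
  \sum_(0 <= a < #|D|.+1) 'C(#|D|, a)%:R * f a.
Proof.
rewrite big_mkord (partition_big (fun A : {set T} => inord #|A| : 'I_(#|D|.+1)) xpredT) //=.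
apply: eq_bigr => a _.
have -> : \sum_(A : {set T} | (A \subset D) && (inord #|A| == a)) f #|A|
   = \sum_(A : {set T} | (A \subset D) && (#|A| == a)%N) f a.
  apply: eq_big => [A|A /andP[AD /eqP <-]]; last by rewrite inordK // ltnS subset_leq_card.
  case AD : (A \subset D) => //=.
  by rewrite -val_eqE /= inordK // ltnS subset_leq_card.
rewrite sumr_const mulr_natl; congr (_ *+ _).
by rewrite -cards_draws; apply: eq_card => A; rewrite !inE.
Qed.

(* Both sides sum over pairs (P, A) of a partition P of D and a block A of P. *)
Lemma sum_set_partitions_rec (f : {set T} -> R) D s :
  s.+1%:R * (\sum_(P in set_partitions D s.+1) \prod_(A in P) f A) =
  \sum_(A : {set T} | (A \subset D) && (A != finset.set0))
     f A * \sum_(P in set_partitions (D :\: A) s) \prod_(B in P) f B.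
Proof.
rewrite mulr_sumr.
transitivity (\sum_(P in set_partitions D s.+1) \sum_(A in P) \prod_(B in P) f B).
  apply: eq_bigr => P; rewrite inE => /andP[_ /eqP cP].
  by rewrite sumr_const cP mulr_natl.
rewrite (exchange_big_dep (fun A : {set T} => (A \subset D) && (A != finset.set0))) /=; last first.
  move=> P A; rewrite inE => /andP[pP _] AP.
  by rewrite (partitionS pP) // (partition_neq0 pP).
apply: eq_bigr => A /andP[AD A0].
(* Deleting the block A maps the partitions of D that contain A bijectively onto the partitions of D
   minus A. *)
rewrite mulr_sumr (reindex_onto (fun P => A |: P) (fun P => P :\ A)) /=; last first.
  by move=> P /andP[_ AP]; rewrite finset.setD1K.
apply: eq_big => P.
  rewrite !inE eqxx andbT /=.
  apply/idP/idP.
    move=> /andP[/andP[pP cP] /eqP PE].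
    have AP : A \notin P by rewrite -PE !inE eqxx.
    move: (partitionD1 pP (setU11 A P)); rewrite PE => -> /=.
    by move: cP; rewrite cardsU1 AP add1n eqSS.
  move=> /andP[pP /eqP cP].
  have AP : A \notin P.
    apply: contra A0 => AP; have := partitionS pP AP.
    by rewrite subsetD => /andP[_]; rewrite -setI_eq0 finset.setIid.
  rewrite setU1K // eqxx andbT cardsU1 AP cP eqxx andbT.
  have dA : fintype.disjoint (mem A) (mem (D :\: A)).
    by rewrite finset.disjoints_subset; apply/fintype.subsetP => x xA; rewrite !inE xA.
  have -> // : finset.partition (A |: P) D.
  suff <- : A :|: (D :\: A) = D by exact: partitionU1 pP A0 dA.
  by rewrite -{1}(finset.setIidPr AD) finset.setID.
rewrite !inE eqxx andbT => /andP[_ /eqP PE].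
by rewrite big_setU1 // -PE !inE eqxx.
Qed.

(** Exponential formula, by induction on s: with n = |D|, the number of ways to choose a block of
    size a, times a! (n - a)!, is n!, and a convolution over a remains. *)
Lemma sum_set_partitions (p : nat -> R) s D :
  \sum_(P in set_partitions D s) \prod_(A in P) ((#|A|)`!%:R * p #|A|) =
  (#|D|)`!%:R / s`!%:R * conv_pow p s #|D|.
Proof.
elim: s D => [|s IH] D.
  case: (eqVneq D finset.set0) => [->|D0].
    rewrite cards0 /= divr1 mulr1 (big_pred1 finset.set0) ?big_set0 // => P.
    by rewrite !inE partition_set0 cards_eq0 andbb.
  rewrite /= cards_eq0 (negbTE D0) mulr0 big1 // => P.
  rewrite inE cards_eq0 => /andP[pP /eqP P0]; move: pP D0.
  by rewrite P0 => /cover_partition <-; rewrite /finset.cover big_set0 eqxx.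
have sn0 : (s.+1%:R : R) != 0 by rewrite pnatr_eq0.
apply: (mulfI sn0); rewrite sum_set_partitions_rec.
under eq_bigr => A /andP[AD _] do rewrite IH cardsD (finset.setIidPr AD).
rewrite big_mkcondr /=.
(* The value 0 at a = 0 encodes the condition that A is nonempty. *)
set F := fun a : nat => if a == 0%N then 0 else
   a`!%:R * p a * ((#|D| - a)`!%:R / s`!%:R * conv_pow p s (#|D| - a)).
transitivity (\sum_(A : {set T} | A \subset D) F #|A|).
  by apply: eq_bigr => A _; rewrite /F cards_eq0; case: eqVneq.
rewrite sum_by_card [LHS]big_ltn // {1}/F mulr0 add0r /= !mulr_sumr.
rewrite !big_nat; apply: eq_bigr => a /andP[a0 aD]; rewrite /F gtn_eqF //.
rewrite -(bin_fact (n := #|D|) (m := a)) // ?factS !natrM.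
by field; rewrite nat1r sn0 pnatr_eq0 -lt0n fact_gt0.
Qed.
End SetPartitions.

(** * Mass and decay of the convolution powers of 1/(a(a+1)) *)

Section ConvolutionBound.
Variable R : realFieldType.
Let p (a : nat) : R := (a * a.+1)%:R^-1.

Lemma pronic_ge0 a : 0 <= p a.
Proof. by rewrite invr_ge0 ler0n. Qed.

(** Telescopes, since 1/(a(a+1)) = 1/a - 1/(a+1). *)
Lemma sum_pronic_le1 n : \sum_(1 <= a < n.+1) p a <= 1.
Proof.
have -> : \sum_(1 <= a < n.+1) p a = 1 - n.+1%:R^-1.
  elim: n => [|n IH]; first by rewrite big_geq // invr1 subrr.
  rewrite big_nat_recr //= IH /p natrM.
  by field; rewrite -!natr1; have := ler0n R n; lra.
by rewrite gerBl invr_ge0 ler0n.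
Qed.

Lemma conv_pow_pronic_ge0 s n : 0 <= conv_pow p s n.
Proof.
elim: s n => [|s IH] n /=; first by rewrite ler0n.
by apply: sumr_ge0 => a _; rewrite mulr_ge0 // pronic_ge0.
Qed.

(** Convolving masses at most 1 gives mass at most 1: after exchanging the sums over m and a, the
    inner one is a shifted partial sum for s. *)
Lemma sum_conv_pow_pronic_le1 s n : \sum_(0 <= m < n) conv_pow p s m <= 1.
Proof.
elim: s n => [|s IH] n /=.
  case: n => [|n]; first by rewrite big_geq.
  by rewrite big_ltn //= big_nat big1 ?addr0 // => -[].
apply: le_trans (sum_pronic_le1 n).
have -> : \sum_(0 <= m < n) \sum_(1 <= a < m.+1) p a * conv_pow p s (m - a) =
    \sum_(0 <= m < n) \sum_(1 <= a < n.+1)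
       if (a < m.+1)%N then p a * conv_pow p s (m - a) else 0.
  rewrite !big_nat; apply: eq_bigr => m /andP[_ mn].
  by rewrite [LHS](big_nat_widen _ _ n.+1) ?ltnS 1?ltnW // big_mkcond.
rewrite exchange_big_nat /= !big_nat; apply: ler_sum => a /andP[a0 an].
rewrite -big_mkcond -[leRHS]mulr1 -mulr_sumr ler_wpM2l ?pronic_ge0 //.
rewrite -(big_nat_widenl a 0 n xpredT) //.
by rewrite -{1}[a]add0n big_addn (eq_bigr (conv_pow p s)) // => i _; rewrite addnK.
Qed.

(* With s + 1 parts: either the first part is at least n/(s+1), and has weight at most
   (s+1)^2/n^2, or the others sum to at least n s/(s+1) and the induction hypothesis
   bounds their weight by s (s+1)^2/n^2. *)
Lemma conv_pow_pronic_le s n : (0 < n)%N -> conv_pow p s n <= s%:R ^+ 3 / n%:R ^+ 2.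
Proof.
elim: s n => [|s IH] n n0 /=; first by rewrite gtn_eqF // expr0n mul0r.
have nR0 : 0 < n%:R :> R by rewrite ltr0n.
have sR0 : 0 < s.+1%:R :> R by rewrite ltr0n.
set S2 := s.+1%:R ^+ 2 / n%:R ^+ 2 : R.
have S20 : 0 <= S2 by rewrite divr_ge0 // exprn_ge0 // ltW.
(* Both bounds are nonnegative, so their sum covers either case without splitting the range of a. *)
apply: (@le_trans _ _ (\sum_(1 <= a < n.+1) (S2 * conv_pow p s (n - a) + p a * (s%:R * S2)))).
  rewrite !big_nat; apply: ler_sum => a /andP[a0 an].
  have aR0 : 0 < a%:R :> R by rewrite ltr0n.
  have [big|small] := leqP n (s.+1 * a).
    apply: ler_wpDr; first by apply: mulr_ge0; [exact: pronic_ge0|exact: mulr_ge0].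
    apply: ler_wpM2r; first exact: conv_pow_pronic_ge0.
    have : p a <= (a%:R ^+ 2)^-1.
      rewrite lef_pV2 ?posrE ?exprn_gt0 // ?ltr0n ?muln_gt0 ?a0 //.
      by rewrite expr2 -natrM ler_nat leq_mul.
    move/le_trans; apply.
    rewrite -[leLHS]mul1r ler_pdivrMr ?exprn_gt0 // /S2 mulrAC ler_pdivlMr ?exprn_gt0 //.
    by rewrite mul1r -exprMn lerXn2r ?nnegrE ?mulr_ge0 ?ler0n // -natrM ler_nat.
  apply: ler_wpDl; first by rewrite mulr_ge0 // conv_pow_pronic_ge0.
  apply: ler_wpM2l; first exact: pronic_ge0.
  have na0 : (0 < n - a)%N by nia.
  apply: le_trans (IH _ na0) _.
  rewrite (exprS _ 2) -mulrA ler_wpM2l // /S2.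
  rewrite ler_pdivrMr ?exprn_gt0 ?ltr0n // mulrAC ler_pdivlMr ?exprn_gt0 //.
  rewrite -!exprMn lerXn2r ?nnegrE ?mulr_ge0 ?ler0n //.
  by rewrite -!natrM ler_nat; nia.
rewrite big_split /= -mulr_sumr -mulr_suml.
have -> : \sum_(1 <= a < n.+1) conv_pow p s (n - a) = \sum_(0 <= m < n) conv_pow p s m.
  rewrite big_add1 /= big_nat_rev /= !big_mkord; apply: eq_bigr => i _.
  by congr (conv_pow p s _); have := ltn_ord i; lia.
have -> : s.+1%:R ^+ 3 / n%:R ^+ 2 = S2 + s%:R * S2.
  by rewrite (exprS _ 2) -mulrA -/S2 -natr1 mulrDl mul1r addrC.
apply: lerD.
  by apply: ler_piMr => //; exact: sum_conv_pow_pronic_le1.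
by apply: ler_piMl; [exact: mulr_ge0|exact: sum_pronic_le1].
Qed.
End ConvolutionBound.

(** * Marginal likelihood of the uniform kernel *)

(* theta contributes to m(x_B) iff ths - gap c (x - ths) B < theta < ths + gap c (ths - x) B;
   overlap is the length of this interval (0 if empty) relative to 2c. *)
Definition gap (R : realType) (c : R) (I : finType) (y : I -> R) (B : {set I}) : R :=
  \big[Num.min/c]_(i in B) (c - y i).

Definition overlap (R : realType) (ths c : R) (I : finType) (x : I -> R) (B : {set I}) : R :=
  Num.max 0 (gap c (fun i => x i - ths) B + gap c (fun i => ths - x i) B) / (2 * c).

Section Marginal.
Variables (R : realType) (ths c : R).
Hypothesis c0 : 0 < c.
Let c20 : 0 < 2 * c. Proof. by rewrite mulr_gt0. Qed.

Lemma overlap_ge0 (I : finType) (x : I -> R) B : 0 <= overlap ths c x B.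
Proof. by rewrite divr_ge0 ?(ltW c20) // le_max lexx. Qed.

(** The integrand is (2c)^-(|B|+1) on one interval and 0 off it, one factor coming from the base
    density; the length of the interval is 2c times [overlap], which cancels that factor. *)
Lemma marg_unif (n : nat) (x : 'I_n -> R) (B : {set 'I_n}) :
  marg (unif_kernel c) (unif_dens ths c) x B = (2 * c)^-1 ^+ #|B| * overlap ths c x B.
Proof.
set gr := gap c (fun i => x i - ths) B; set gl := gap c (fun i => ths - x i) B.
rewrite /marg (_ : (fun th => _) =
  (fun th => (2 * c)^-1 ^+ #|B|.+1 * \1_(`]ths - gr, ths + gl[%classic) th)); last first.
  apply/funext => th; rewrite indicE mem_setE in_itv /=.
  have -> : (ths - gr < th < ths + gl) =
      [forall (i | i \in B), (th - c < x i) && (x i < th + c)] &&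
      ((ths - c < th) && (th < ths + c)).
    rewrite ltrBlDr -ltrBlDl -ltrBlDl.
    apply/andP/andP => [[/bigmin_gtP[a1 a2] /bigmin_gtP[b1 b2]]|[/forall_inP H /andP[a b]]].
      split; last by apply/andP; split; lra.
      by apply/forall_inP => i iB; move: (a2 i iB) (b2 i iB) => ? ?; apply/andP; split; lra.
    by split; apply/bigmin_gtP; split => [|i /H /andP[? ?]]; lra.
  rewrite /unif_dens; case: ifP => _; last by rewrite andbF !mulr0.
  rewrite andbT; case: (boolP [forall (i | _), _]) => [/forall_inP H|].
    rewrite (eq_bigr (fun=> (2 * c)^-1)) => [|i /H]; last by rewrite /unif_kernel => ->.
    by rewrite prodr_const mulr1 exprSr.
  rewrite negb_forall_in => /exists_inP[i iB /negbTE k0].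
  by rewrite (bigD1 i) //= {1}/unif_kernel k0 !mul0r mulr0.
rewrite /Rintegral (_ : (fun th => _) = (fun th => ((2 * c)^-1 ^+ #|B|.+1)%:E *
   (\1_(`]ths - gr, ths + gl[%classic) th)%:E)%E) //.
rewrite ge0_integralZl //; last 2 first.
- by apply/measurable_EFinP; apply: measurable_indic.
- by rewrite lee_fin exprn_ge0 // invr_ge0 ltW.
rewrite integral_indic // setIT /= lebesgue_measure_itv /= lte_fin.
rewrite /overlap -/gr -/gl; case: ltP => lt.
  rewrite -EFinB -EFinM /= max_r; last by lra.
  by rewrite exprSr -mulrA; congr (_ * _); rewrite mulrC; congr (_ / _); lra.
by rewrite mule0 /= max_l ?mul0r ?mulr0 //; lra.
Qed.

(** Discrete layer-cake bound, by induction on K: if h K < g then all grid points up to h K lie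
    below g; otherwise the induction hypothesis applies. *)
Lemma le_step_count (h g : R) K : 0 <= h -> g <= h * K%:R ->
  g <= h * \sum_(j < K) (h * j%:R < g)%R%:R.
Proof.
move=> h0; elim: K => [|K IH] gK; first by rewrite big_ord0.
rewrite big_ord_recr /=; case: (ltP (h * K%:R) g) => [lt|/IH le]; last first.
  by rewrite addr0.
apply: le_trans gK _; rewrite ler_wpM2l // -natr1 lerD2r.
rewrite -[K in K%:R]card_ord -sumr_const; apply: ler_sum => i _.
by rewrite (le_lt_trans _ lt) // ler_wpM2l // ler_nat ltnW.
Qed.

(** A minimum exceeds a level iff all its terms do, so the indicator attached to each grid point
    becomes a product over B, the form that independence can use. *)
Lemma gap_le (K : nat) (I : finType) (y : I -> R) (B : {set I}) : (0 < K)%N ->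
  gap c y B <= c / K%:R * \sum_(j < K) \prod_(i in B) (y i < c - c / K%:R * j%:R)%R%:R.
Proof.
move=> K0; have h0 : 0 <= c / K%:R by rewrite divr_ge0 // ltW.
have gK : gap c y B <= c / K%:R * K%:R.
  rewrite divfK ?pnatr_eq0 -?lt0n // /gap.
  by elim/big_rec: _ => // i a _ ac; rewrite ge_min ac orbT.
apply: le_trans (le_step_count h0 gK) _.
rewrite ler_wpM2l //; apply: ler_sum => j _.
case: bigmin_gtP => [[_ H]|_]; last by apply: prodr_ge0.
rewrite big1 // => i /H; rewrite ltrBrDr -ltrBrDl => ->//.
Qed.

End Marginal.

(** * Expectation of products over blocks *)

Lemma indic_bigcap_ord (R : comPzRingType) (T : Type) n (F : nat -> set T) w :
  \1_(\bigcap_(i in `I_n) F i) w = \prod_(i < n) \1_(F i) w :> R.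
Proof.
rewrite indicE; case: (boolP (w \in _)) => [/set_mem H|].
  rewrite big1 // => i _; rewrite indicE mem_set //; exact: H (ltn_ord i).
rewrite notin_setE => nH.
have [i [ni Fi]] : exists i, (i < n)%N /\ ~ F i w.
  apply: contrapT => /forallNP H; apply: nH => i ni; apply: contrapT => Fi.
  by apply: (H i).
by rewrite (bigD1 (Ordinal ni)) //= indicE memNset ?mul0r.
Qed.

Section Independence.
Context d (Omega : measurableType d) (R : realType) (P : probability Omega R).
Variable X : nat -> Omega -> R.
Hypothesis hXm : forall i, measurable_fun setT (X i).
Hypothesis hXind : mutually_independent P X.

(** The product of sums expands over the maps f that choose a set for each block, [j0] being the
    value of f outside Q. Each term is the indicator of an event fixing a set for every X_i, whose
    probability factors by independence; after bounding each factor the expansion is folded back. *)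
Lemma integral_prod_blocks_le (J : finType) (S : J -> set R) (q : J -> R)
    n (Q : {set {set 'I_n}}) (j0 : J) :
  (forall k, measurable (S k)) ->
  (forall i k, (P (X i @^-1` S k) <= (q k)%:E)%E) ->
  finset.partition Q [set: 'I_n] ->
  (\int[P]_w (\prod_(A in Q) \sum_k \prod_(i in A) \1_(S k) (X i w))%:E
    <= (\prod_(A in Q) \sum_k q k ^+ #|A|)%:E)%E.
Proof.
move=> mS qS pQ.
(* Indices beyond n get the full space, as [mutually_independent] takes an infinite sequence of
   Borel sets. *)
pose B (f : {ffun {set 'I_n} -> J}) (i : nat) : set R :=
  if (insub i : option 'I_n) is Some o then S (f (finset.pblock Q o)) else setT.
have mB f i : measurable (B f i) by rewrite /B; case: insub.
pose E f := \bigcap_(i in `I_n) (X i @^-1` B f i).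
have mX i A : measurable A -> measurable (X i @^-1` A).
  by move=> mA; rewrite -[_ @^-1` _]setTI; exact: hXm.
have mE f : measurable (E f) by apply: bigcap_measurableType => i _; exact: mX.
have blockE (V : comPzRingType) f (F : 'I_n -> J -> V) :
    \prod_(A in Q) \prod_(i in A) F i (f A) = \prod_(i < n) F i (f (finset.pblock Q i)).
  transitivity (\prod_(i in [set: 'I_n]%SET) F i (f (finset.pblock Q i))).
    rewrite (set_partition_big _ pQ); apply: eq_bigr => A AQ; apply: eq_bigr => i iA.
    by rewrite (def_pblock (partition_trivIset pQ) AQ iA).
  by apply: eq_bigl => i; rewrite !inE.
under eq_integral => w _.
  rewrite (big_distr_big j0) /=.
  under eq_bigr => f _.
    rewrite (_ : \prod_(_ in _) _ = \1_(E f) w); last first.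
      rewrite indic_bigcap_ord (blockE _ f (fun i k => \1_(S k) (X i w))).
      by apply: eq_bigr => i _; rewrite !indicE /B valK.
    over.
  rewrite -sumEFin -big_filter; over.
rewrite ge0_integral_sum //; last first.
  by move=> f; apply/measurable_EFinP; exact: measurable_indic.
have intE f : (\int[P]_w (\1_(E f) w)%:E = P (E f))%E.
  by rewrite integral_indic // setIT.
rewrite (eq_bigr (fun f => P (E f))) => [|f _]; last exact: intE.
rewrite (big_distr_big j0) /= -sumEFin -[leRHS]big_filter; apply: lee_sum => f _.
rewrite /E hXind //.
pose r i := fine (P (X i @^-1` B f i)).
have rE i : P (X i @^-1` B f i) = (r i)%:E by rewrite fineK // fin_num_measure //; exact: mX.
rewrite (eq_bigr (fun i : 'I_n => (r i)%:E)) => [|i _]; last exact: rE.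
rewrite prodEFin lee_fin.
under [leRHS]eq_bigr => A _ do rewrite -prodr_const.
rewrite (blockE _ f (fun=> q)).
apply: ler_prod => i _; rewrite -!lee_fin -rE measure_ge0 /=.
by rewrite /B valK.
Qed.
End Independence.

(** Sums the increments (m+1)^(a+1) - m^(a+1) >= (a+1) m^a. *)
Lemma sum_expn_le (a N : nat) : (a.+1 * \sum_(m < N) m ^ a <= N ^ a.+1)%N.
Proof.
have step m : (m ^ a.+1 + a.+1 * m ^ a <= m.+1 ^ a.+1)%N.
  elim: a => [|a IH]; first by rewrite expn0 !expn1; lia.
  rewrite [leqRHS]expnS; apply: leq_trans (leq_mul (leqnn m.+1) IH).
  by rewrite (expnS m a.+1) (expnS m a); nia.
elim: N => [|N IH]; first by rewrite big_ord0 muln0.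
by rewrite big_ord_recr /= mulnDr (leq_trans _ (step N)) // leq_add2r.
Qed.

(** In the constant 4, one factor 2 counts the two boolean values; the other absorbs the endpoint
    term N^a, N = 2K, which is at most N^(a+1)/(a+1) because a < N. *)
Lemma sum_grid_le (R : realType) (a K : nat) : (a < 2 * K)%N ->
  (2 * K)%:R^-1 * (\sum_(k : bool * 'I_K) ((2 * K - k.2)%:R / (2 * K)%:R) ^+ a) <=
  4 / a.+1%:R :> R.
Proof.
set N := (2 * K)%N => aN.
have N0 : 0 < N%:R :> R by rewrite ltr0n; lia.
have H : (a.+1 * \sum_(j < K) (N - j) ^ a <= 2 * N ^ a.+1)%N.
  have le1 : (\sum_(j < K) (N - j) ^ a <= \sum_(m < N) m ^ a + N ^ a)%N.
    rewrite (@leq_trans (\sum_(j < N) (N - j) ^ a)) //.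
      rewrite (@big_ord_widen _ _ _ K N (fun j => (N - j) ^ a)%N); last by rewrite /N; lia.
      by rewrite big_mkcond leq_sum // => i _; case: ifP.
    rewrite (reindex_inj rev_ord_inj) /=.
    rewrite (eq_bigr (fun m : 'I_N => m.+1 ^ a)%N) => [|m _]; last first.
      by congr (_ ^ _)%N; have := ltn_ord m; lia.
    rewrite -(big_mkord xpredT (fun m => m.+1 ^ a)%N) -(big_mkord xpredT (fun m => m ^ a)%N).
    rewrite -(big_add1 _ _ 0 N.+1 xpredT (fun m => m ^ a)%N) -big_nat_recr //=.
    by rewrite [leqRHS]big_ltn // leq_addl.
  have := sum_expn_le a N; rewrite expnS; nia.
clearbody N.
rewrite -(pair_bigA _ (fun (b : bool) (j : 'I_K) => ((N - j)%:R / N%:R) ^+ a)) /=.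
rewrite big_bool /= -mulr2n -[_ *+ 2]mulr_natl.
under eq_bigr => j _ do rewrite expr_div_n -natrX.
rewrite -mulr_suml -natr_sum.
move: H; rewrite -(ler_nat R) !natrM natrX exprS => H.
set S := (\sum_(j < K) _)%:R in H *.
rewrite ler_pdivlMr ?ltr0n // -(ler_pM2r N0) -(@ler_pM2r _ (N%:R ^+ a)) ?exprn_gt0 //.
have e : N%:R^-1 * (2 * (S / N%:R ^+ a)) * a.+1%:R * N%:R * N%:R ^+ a = 2 * (a.+1%:R * S).
  by field; rewrite expf_neq0 gt_eqF.
by rewrite e -!mulrA; lra.
Qed.

Lemma measurable_prod_cond d (T : measurableType d) (R : realType) (I : finType)
    (Q : pred I) (h : I -> T -> R) :
  (forall i, measurable_fun setT (h i)) ->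
  measurable_fun setT (fun w => \prod_(i | Q i) h i w).
Proof.
move=> mh; under eq_fun do rewrite big_mkcond.
by apply: measurable_prod => i _; case: (Q i) => //; exact: measurable_cst.
Qed.

(** * Riemann sums in theta and the mean of products of overlaps *)

Section Slab.
Variables (R : realType) (ths c : R).
Hypothesis c0 : 0 < c.
Let c20 : 0 < 2 * c. Proof. by rewrite mulr_gt0. Qed.

(** Among the x in ]ths - c, ths + c[, those within distance c of the grid value theta = ths - c j /
    K ([true]) or theta = ths + c j / K ([false]). *)
Definition slab (K : nat) (k : bool * 'I_K) : set R :=
  [set x | (if k.1 then x - ths else ths - x) < c - c / K%:R * k.2%:R].

Lemma measurable_slab K k : measurable (@slab K k).
Proof.
rewrite /slab; case: k.1.
  rewrite (_ : [set x | _] = `]-oo, (c - c / K%:R * k.2%:R) + ths[%classic) //.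
  by apply/seteqP; split => x; rewrite /= in_itv /= ltrBlDr.
rewrite (_ : [set x | _] = `]ths - (c - c / K%:R * k.2%:R), +oo[%classic) //.
by apply/seteqP; split => x; rewrite /= in_itv /= andbT ltrBlDr addrC -ltrBlDr.
Qed.

(* A Riemann sum in theta: each term is a product over i, so independence applies to
   products of overlaps by finite expansion. *)
Lemma overlap_le_slabs K (I : finType) (x : I -> R) (B : {set I}) : (0 < K)%N ->
  overlap ths c x B <=
  (2 * K)%:R^-1 * \sum_(k : bool * 'I_K) \prod_(i in B) \1_(slab k) (x i).
Proof.
move=> K0; have KR : 0 < K%:R :> R by rewrite ltr0n.
rewrite -(pair_bigA _ (fun b j => \prod_(i in B) \1_(slab (b, j)) (x i))) /= big_bool /=.
set S1 := \sum_(j < K) _; set S2 := \sum_(j < K) _.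
have g1 : gap c (fun i => x i - ths) B <= c / K%:R * S1.
  apply: le_trans (gap_le c0 _ _ K0) _; rewrite le_eqVlt; apply/orP; left.
  apply/eqP; congr (_ * _); apply: eq_bigr => j _; apply: eq_bigr => i _.
  by rewrite indicE mem_setE.
have g2 : gap c (fun i => ths - x i) B <= c / K%:R * S2.
  apply: le_trans (gap_le c0 _ _ K0) _; rewrite le_eqVlt; apply/orP; left.
  apply/eqP; congr (_ * _); apply: eq_bigr => j _; apply: eq_bigr => i _.
  by rewrite indicE mem_setE.
have S0 : 0 <= S1 + S2 by rewrite addr_ge0 // sumr_ge0 // => j _; apply: prodr_ge0.
rewrite /overlap ler_pdivrMr // ge_max; apply/andP; split.
  by rewrite !mulr_ge0 ?invr_ge0 // ltW.
have -> : (2 * K)%:R^-1 * (S1 + S2) * (2 * c) = c / K%:R * S1 + c / K%:R * S2.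
  by rewrite natrM; field; rewrite gt_eqF.
exact: lerD.
Qed.

Context d (Omega : measurableType d) (P : probability Omega R).
Variable X : nat -> Omega -> R.
Hypothesis hXm : forall i, measurable_fun setT (X i).
Hypothesis hXunif : forall i (A : set R), measurable A ->
  P (X i @^-1` A) =
  (\int[@lebesgue_measure R]_(x in A) (uniform_pdf (ths - c) (ths + c) x)%:E)%E.

Lemma unif_prob_le i (A : set R) (a b : R) : measurable A -> a <= b ->
  A `&` `[ths - c, ths + c] `<=` `[a, b]%classic ->
  (P (X i @^-1` A) <= ((b - a) / (2 * c))%:E)%E.
Proof.
move=> mA ab Aab; rewrite hXunif // integral_uniform_pdf.
have mI : measurable (A `&` `[ths - c, ths + c]) by exact: measurableI.
rewrite (eq_integral (cst ((2 * c)^-1)%:E)) => [|x /set_mem[_]]; last first.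
  rewrite /= in_itv /= /uniform_pdf => ->.
  by congr (_%:E); congr (_^-1); lra.
rewrite integral_cst //= [X in (_ <= X%:E)%E]mulrC EFinM.
apply: lee_wpmul2l; first by rewrite lee_fin invr_ge0 ltW.
apply: (@le_trans _ _ (lebesgue_measure `[a, b])); first by apply: le_measure; rewrite ?inE.
by rewrite lebesgue_measure_itv /= lte_fin; case: ltP => // _; rewrite lee_fin subr_ge0.
Qed.

(** The slab misses a piece of length c j / K at one end of the range, that is a fraction j / (2K)
    of it. *)
Lemma slab_prob_le i K (k : bool * 'I_K) :
  (P (X i @^-1` slab k) <= ((2 * K - k.2)%:R / (2 * K)%:R)%:E)%E.
Proof.
case: k => b j; have KR : 0 < K%:R :> R by rewrite ltr0n; have := ltn_ord j; lia.
have jK : j%:R <= K%:R :> R by rewrite ler_nat ltnW.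
set t := c / K%:R * j%:R.
have tc : t <= c by rewrite /t mulrAC ler_pdivrMr // ler_wpM2l // ltW.
have -> : (2 * K - (b, j).2)%:R / (2 * K)%:R = (2 * c - t) / (2 * c).
  rewrite natrB /=; last by have := ltn_ord j; lia.
  by rewrite /t natrM; field; rewrite !gt_eqF.
have tE : t = c / K%:R * j%:R by [].
have c1 := c0; clearbody t; case: b.
  apply: le_trans (@unif_prob_le i _ (ths - c) (ths + c - t) (measurable_slab _) _ _) _.
- by lra.
  - move=> x; rewrite /slab /= !in_itv /= -tE => -[? /andP[? ?]]; apply/andP; split; lra.
  - by rewrite lee_fin ler_wpM2r ?invr_ge0 ?(ltW c20) //; lra.
apply: le_trans (@unif_prob_le i _ (ths - c + t) (ths + c) (measurable_slab _) _ _) _.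
- by lra.
- move=> x; rewrite /slab /= !in_itv /= -tE => -[? /andP[? ?]]; apply/andP; split; lra.
- by rewrite lee_fin ler_wpM2r ?invr_ge0 ?(ltW c20) //; lra.
Qed.

Hypothesis hXind : mutually_independent P X.

Lemma measurable_overlap n (A : {set 'I_n}) :
  measurable_fun setT (fun w => overlap ths c (fun i : 'I_n => X i w) A).
Proof.
have mgap (y : 'I_n -> Omega -> R) : (forall i, measurable_fun setT (y i)) ->
    measurable_fun setT (fun w => gap c (y ^~ w) A).
  move=> my; rewrite /gap; elim: (index_enum _) => [|i s IH].
    by under eq_fun do rewrite big_nil; exact: measurable_cst.
  under eq_fun do rewrite big_cons; case: (i \in A) => //.
  by apply: measurable_minr => //; exact: measurable_funB.
apply: measurable_funM => //; apply: measurable_maxr => //; apply: measurable_funD.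
  by apply: (mgap (fun i w => X i w - ths)) => i; exact: measurable_funB.
by apply: (mgap (fun i w => ths - X i w)) => i; exact: measurable_funB.
Qed.

(** Each overlap is bounded pointwise by a Riemann sum on one fixed grid, so no limit in the mesh is
    taken; the expanded product is then handled by independence. *)
Lemma integral_prod_overlap_le n (Q : {set {set 'I_n}}) :
  finset.partition Q [set: 'I_n] ->
  (\int[P]_w (\prod_(A in Q) overlap ths c (fun i : 'I_n => X i w) A)%:E
    <= (\prod_(A in Q) (4 / #|A|.+1%:R))%:E)%E.
Proof.
(* Block sizes are at most n < 2K, as [sum_grid_le] requires. *)
move=> pQ; pose K := n.+1.
have j0 : bool * 'I_K := (true, ord0).
pose G (A : {set 'I_n}) w : R := \sum_(k : bool * 'I_K) \prod_(i in A) \1_(slab k) (X i w).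
have mG A : measurable_fun setT (G A).
  apply: measurable_sum => k; apply: measurable_prod_cond => i.
  by apply: measurableT_comp => //; apply: measurable_indic; exact: measurable_slab.
have G0 A w : 0 <= G A w by apply: sumr_ge0 => k _; apply: prodr_ge0.
have mprodG : measurable_fun setT (fun w => (\prod_(A in Q) G A w)%:E).
  by apply/measurable_EFinP; apply: measurable_prod_cond.
apply: (@le_trans _ _ (\int[P]_w (((2 * K)%:R^-1 ^+ #|Q|)%:E * (\prod_(A in Q) G A w)%:E))%E).
  apply: ge0_le_integral => //.
  - by move=> w _; rewrite lee_fin prodr_ge0 // => A _; exact: overlap_ge0.
  - apply/measurable_EFinP; apply: measurable_prod_cond => A; exact: measurable_overlap.
  - apply: emeasurable_funM => //; exact: mprodG.
  - move=> w _; rewrite -EFinM lee_fin -prodr_const -big_split /=.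
    apply: ler_prod => A _; rewrite overlap_ge0 //=.
    exact: overlap_le_slabs.
rewrite ge0_integralZl_EFin //; last first.
  by move=> w _; rewrite lee_fin prodr_ge0.
apply: le_trans (lee_wpmul2l _
  (integral_prod_blocks_le hXm hXind j0 (@measurable_slab K) (fun i => @slab_prob_le i K) pQ)) _.
  by rewrite lee_fin exprn_ge0 // invr_ge0.
rewrite -EFinM lee_fin -prodr_const -big_split /=.
apply: ler_prod => A _; apply/andP; split.
  rewrite mulr_ge0 ?invr_ge0 // sumr_ge0 // => k _; rewrite exprn_ge0 // divr_ge0 //.
apply: sum_grid_le.
have := subset_leq_card (finset.subsetT A); rewrite cardsT card_ord => An.
by rewrite (leq_ltn_trans An) // /K mul2n -addnn ltn_addr.
Qed.
End Slab.

(** * Moments of the prior *)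

Lemma expR_ge_term (R : realType) (x : R) n : 0 <= x -> x ^+ n / n`!%:R <= expR x.
Proof.
case: n => [|n] x0; first by rewrite expr0 divr1 -expR0 ler_expR.
by apply: le_trans (expR_ge1Dxn n x0); rewrite lerDr.
Qed.

Lemma expn_le_expR (R : realType) (k t : R) n : 0 < k -> 0 <= t ->
  t ^+ n <= k ^+ n * n`!%:R * expR (t / k).
Proof.
move=> k0 t0; have /(expR_ge_term n) : 0 <= t / k by rewrite divr_ge0 ?(ltW k0).
rewrite ler_pdivrMr ?ltr0n ?fact_gt0 // expr_div_n ler_pdivrMr ?exprn_gt0 //.
by move/le_trans; apply; rewrite le_eqVlt; apply/orP; left; apply/eqP; ring.
Qed.

Lemma sum_geometric_le (R : realType) (z : R) n : 0 <= z -> z < 1 ->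
  \sum_(i < n) z ^+ i <= (1 - z)^-1.
Proof.
move=> z0 z1; rewrite -[leRHS]mul1r ler_pdivlMr ?subr_gt0 // mulrC.
rewrite -opprB mulNr -subrX1 opprB gerBl exprn_ge0 //.
Qed.

Section Gamma.
Variable R : realType.
Local Notation mu := (@lebesgue_measure R).

Lemma powR_le_expR (nu : R) : 0 <= nu ->
  exists2 C, 0 <= C & forall t, 0 < t -> t `^ nu <= C * expR (t / 4).
Proof.
move=> nu0; pose N := Num.bound nu.
have nuN : nu <= N%:R by apply: ltW; apply: archi_boundP.
exists (1 + 4 ^+ N * N`!%:R) => [|t t0].
  by rewrite addr_ge0 // mulr_ge0 // exprn_ge0.
have e1 : 1 <= expR (t / 4) by rewrite -expR0 ler_expR divr_ge0 ?ltW.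
rewrite mulrDl mul1r.
have e2 : t ^+ N <= 4 ^+ N * N`!%:R * expR (t / 4).
  by rewrite expn_le_expR ?ltW.
have e0 : 0 <= 4 ^+ N * N`!%:R * expR (t / 4).
  by apply: le_trans e2; rewrite exprn_ge0 ?ltW.
have [t1|t1] := leP t 1.
  apply: (@le_trans _ _ 1); last by rewrite (le_trans e1) // lerDl.
  by rewrite -(powRr0 t) ger_powR // t0.
apply: (@le_trans _ _ (t ^+ N)); last by rewrite (le_trans e2) // lerDr expR_ge0.
by rewrite -powR_mulrn ?(ltW t0) // ler_powR // ltW.
Qed.

(** The exponential is spent in pieces: t^nu <= C e^(t/4), t^s <= 2^s s! e^(t/2), and the remaining
    e^(-t/4) is 4 times an exponential density of rate 1/4. *)
Lemma Gamma_le (nu : R) : 0 <= nu ->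
  exists2 C, 0 <= C & forall s : nat, Gamma (nu + s%:R + 1) <= C * 2 ^+ s * s`!%:R.
Proof.
move=> /powR_le_expR[C C0 HC]; exists (4 * C) => [|s]; first by rewrite mulr_ge0.
have mpos : measurable (@posR R) by exact: measurable_itv.
rewrite /Gamma /Rintegral addrK.
set B := 4 * C * _ * _.
have B0 : 0 <= B by rewrite /B !mulr_ge0 // exprn_ge0.
have H : ((\int[mu]_(t in @posR R) (t `^ (nu + s%:R) * expR (- t))%:E) <= B%:E)%E.
  apply: (@le_trans _ _ (\int[mu]_(t in @posR R) (B%:E * (exponential_pdf 4^-1 t)%:E))%E).
    apply: ge0_le_integral => //.
    - by move=> t _; rewrite lee_fin mulr_ge0 ?powR_ge0 ?expR_ge0.
    - by apply/measurable_EFinP; apply: measurable_funM; apply: measurable_funTS;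
        [exact: measurable_powR|exact: measurableT_comp].
    - apply: emeasurable_funM => //; apply/measurable_EFinP; apply: measurable_funTS.
      exact: measurable_exponential_pdf.
    - move=> t; rewrite /posR /= in_itv /= andbT => t0.
      rewrite -EFinM lee_fin exponential_pdfE ?(ltW t0) //.
      rewrite powRD ?(gt_eqF t0) ?implybT // powR_mulrn ?(ltW t0) //.
      have h1 := HC _ t0.
      have h2 : t ^+ s <= 2 ^+ s * s`!%:R * expR (t / 2).
        by rewrite expn_le_expR ?ltW.
      apply: (@le_trans _ _ (C * expR (t / 4) * (2 ^+ s * s`!%:R * expR (t / 2)) * expR (- t))).
        by rewrite ler_wpM2r ?expR_ge0 // ler_pM ?powR_ge0 // exprn_ge0 // ltW.
      have -> : expR (- 4^-1 * t) = expR (t / 4) * expR (t / 2) * expR (- t).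
        by rewrite -!expRD; congr expR; field.
      by rewrite /B le_eqVlt; apply/orP; left; apply/eqP; field.
  have mexp : measurable_fun setT (EFin \o exponential_pdf (4^-1 : R)).
    by apply/measurable_EFinP; exact: measurable_exponential_pdf.
  have exp0 t : (0 <= (exponential_pdf (4^-1 : R) t)%:E)%E.
    by rewrite lee_fin exponential_pdf_ge0.
  rewrite ge0_integralZl_EFin //; last exact: measurable_funTS.
  rewrite -[leRHS]mule1; apply: lee_wpmul2l; first by rewrite lee_fin.
  rewrite -(@integral_exponential_pdf R 4^-1) //.
  exact: ge0_subset_integral.
have I0 : (0 <= \int[mu]_(t in @posR R) (t `^ (nu + s%:R) * expR (- t))%:E)%E.
  by apply: integral_ge0 => t _; rewrite lee_fin mulr_ge0 ?powR_ge0 ?expR_ge0.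
by case: (\int[mu]_(t in _) _)%E H I0.
Qed.
End Gamma.

(* rising a m.+1 = a * m! / damp m a *)
Definition damp (R : realType) (m : nat) (a : R) : R :=
  (\prod_(i < m) (1 + a / i.+1%:R))^-1.

Lemma measurable_invr (R : realType) : measurable_fun setT (@GRing.inv R).
Proof.
rewrite -(setvU [set 0]); apply/measurable_funU => //.
  exact: measurableC.
split; last exact: measurable_fun_set1.
apply: open_continuous_measurable_fun.
  by apply: closed_openC; exact: closed_eq.
by move=> x; rewrite inE /= => /eqP x0; exact: inv_continuous.
Qed.

Lemma le_sum_prod1D (R : realType) (I : finType) (y : I -> R) :
  (forall i, 0 <= y i) -> 1 + \sum_i y i <= \prod_i (1 + y i).
Proof.
move=> y0; pose K (s p : R) := 0 <= s /\ 1 + s <= p.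
suff [] : K (\sum_i y i) (\prod_i (1 + y i)) by [].
apply: (big_ind2 K) => [|s1 p1 s2 p2 [s10 sp1] [s20 sp2]|i _]; rewrite /K.
- by rewrite addr0.
- by split; nra.
- by [].
Qed.

Section Damping.
Variable R : realType.
Implicit Types (a b : R).

Lemma damp_gt0 m a : 0 <= a -> 0 < damp m a.
Proof.
move=> a0; rewrite invr_gt0; apply: prodr_gt0 => i _.
by rewrite ltr_pwDl // divr_ge0.
Qed.

Lemma damp_anti m a b : 0 <= a -> a <= b -> damp m b <= damp m a.
Proof.
move=> a0 ab; have b0 := le_trans a0 ab.
rewrite lef_pV2 ?posrE; last 2 first.
- by rewrite -invr_gt0 -/(damp m b) damp_gt0.
- by rewrite -invr_gt0 -/(damp m a) damp_gt0.
apply: ler_prod => i _; rewrite addr_ge0 ?divr_ge0 //=.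
by rewrite lerD2l ler_wpM2r ?invr_ge0.
Qed.

Lemma damp_le1 m a : 0 <= a -> damp m a <= 1.
Proof.
move=> a0; have -> : 1 = damp m (0 : R).
  by rewrite /damp big1 ?invr1 // => i _; rewrite mul0r addr0.
exact: damp_anti.
Qed.

Lemma rising_damp s m a : 0 < a ->
  a ^+ s.+1 / rising a m.+1 = a ^+ s * damp m a / m`!%:R.
Proof.
move=> a0; rewrite /rising big_ord_recl addr0 /damp.
have -> : \prod_(i < m) (a + (lift ord0 i)%:R) = m`!%:R * \prod_(i < m) (1 + a / i.+1%:R).
  rewrite fact_prod big_add1 big_mkord natr_prod -big_split /=.
  by apply: eq_bigr => i _; rewrite /bump add1n mulrDr mulr1 mulrC divfK ?pnatr_eq0 // addrC.
set p := \prod_(i < m) _.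
have p0 : p != 0 by rewrite gt_eqF // -invr_gt0 -/(damp m a) damp_gt0 // ltW.
rewrite exprS; field.
by rewrite p0 (gt_eqF a0) pnatr_eq0 -lt0n fact_gt0.
Qed.

Lemma measurable_damp m : measurable_fun setT (@damp R m).
Proof.
rewrite (_ : @damp R m = fun a => \prod_(i < m) (1 + a / i.+1%:R)^-1); last first.
  by apply/funext => a; rewrite /damp prodfV.
apply: measurable_prod => i _; apply: measurableT_comp; first exact: measurable_invr.
by apply: measurable_funD => //; exact: measurable_funM.
Qed.

(** The ratio of the two values is a product of factors 1 + y_i with y_i >= eta / (3(i+1)), because
    eta / (i+1) <= 1; it is therefore at least a multiple of the harmonic sum. *)
Lemma damp_ratio m (eta : R) : 0 < eta -> eta <= 1 ->
  damp m eta * (eta / 3 * \sum_(i < m) i.+1%:R^-1) <= damp m (eta / 2).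
Proof.
move=> e0 e1.
have p0 (i : nat) : 0 < 1 + eta / i.+1%:R by rewrite ltr_pwDl // divr_ge0 // ltW.
have q0 (i : nat) : 0 < 1 + eta / 2 / i.+1%:R by rewrite ltr_pwDl // !divr_ge0 // ltW.
have -> : damp m (eta / 2) = damp m eta * \prod_(i < m) ((1 + eta / i.+1%:R) / (1 + eta / 2 / i.+1%:R)).
  rewrite /damp prodf_div mulrA mulVf ?mul1r // gt_eqF //; exact: prodr_gt0.
rewrite ler_pM2l ?damp_gt0 ?(ltW e0) //.
pose y (i : 'I_m) : R := (eta / 2 / i.+1%:R) / (1 + eta / 2 / i.+1%:R).
have y0 i : 0 <= y i by rewrite divr_ge0 ?(ltW (q0 _)) // !divr_ge0 // ltW.
have -> : \prod_(i < m) ((1 + eta / i.+1%:R) / (1 + eta / 2 / i.+1%:R)) = \prod_(i < m) (1 + y i).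
  apply: eq_bigr => i _; rewrite /y; have := q0 i; set z := i.+1%:R^-1 => qz.
  by field; rewrite gt_eqF //; lra.
apply: le_trans _ (le_sum_prod1D y0); apply: ler_wpDl => //.
rewrite mulr_sumr; apply: ler_sum => i _.
rewrite /y ler_pdivlMr //; set z := i.+1%:R^-1.
have z0 : 0 <= z by rewrite invr_ge0.
have z1 : z <= 1 by rewrite invf_le1 ?ltr0n // ler1n.
have u0 : 0 <= eta * z by rewrite mulr_ge0 // (ltW e0).
have u1 : eta * z <= 1 by rewrite mulr_ile1 // (ltW e0).
by nra.
Qed.

Lemma harmonic_unbounded (M : R) :
  exists N, forall m, (N <= m)%N -> M <= \sum_(i < m) i.+1%:R^-1.
Proof.
have nd : nondecreasing_seq (series (@harmonic R)).
  by apply/nondecreasing_seqP => n; rewrite seriesSr lerDl invr_ge0.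
have /cvgryPge/(_ M) [N _ HN] := nondecreasing_dvgn_lt nd (@dvg_harmonic R).
by exists N => m /HN; rewrite /series /= big_mkord.
Qed.

End Damping.

(** * Moments of the prior with and without damping *)

Section Prior.
Variables (R : realType) (pi : R -> R).
Local Notation mu := (@lebesgue_measure R).
Local Notation posR := (@posR R).
Hypotheses (hA1 : A1 pi) (hA2 : A2 pi) (hA3 : A3_ge 38 pi).

Definition moment (s : nat) : R := Rintegral mu posR (fun a => a ^+ s * pi a).

(** For n = m + 1 this is m! times the prior integral of alpha^(s+1) / alpha^(n); both indices are
    shifted by one. *)
Definition dmoment (m s : nat) : R :=
  Rintegral mu posR (fun a => a ^+ s * damp m a * pi a).

Let mpos : measurable posR. Proof. exact: measurable_itv. Qed.
Let posP a : posR a -> 0 < a. Proof. by rewrite /Defs.posR /= in_itv /= andbT. Qed.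
Let pi_ge0 a : posR a -> 0 <= pi a. Proof. by move=> /posP; exact: hA1.2.1. Qed.
Let mpi : measurable_fun posR pi. Proof. exact: measurable_funTS hA1.1. Qed.

Let iZ k (f : R -> R) : mu.-integrable posR (EFin \o f) ->
  mu.-integrable posR (EFin \o (fun a => k * f a)).
Proof.
move=> i; rewrite (_ : EFin \o _ = (fun a => k%:E * (EFin \o f) a)%E).
  exact: integrableZl.
by apply/funext => a; rewrite /= EFinM.
Qed.

Let iD (f g : R -> R) : mu.-integrable posR (EFin \o f) ->
  mu.-integrable posR (EFin \o g) ->
  mu.-integrable posR (EFin \o (fun a => f a + g a)).
Proof.
move=> i j; rewrite (_ : EFin \o _ = (EFin \o f) \+ (EFin \o g))%E.
  exact: integrableD.
by apply/funext => a; rewrite /= EFinD.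
Qed.

Lemma integrable_moment s : mu.-integrable posR (EFin \o (fun a => a ^+ s * pi a)).
Proof.
apply/integrableP; split.
  by apply/measurable_EFinP; apply: measurable_funM => //; apply: measurable_funX.
have -> : (\int[mu]_(a in posR) `|(a ^+ s * pi a)%:E| =
    \int[mu]_(a in posR) (a ^+ s * pi a)%:E)%E.
  apply: eq_integral => a /set_mem ap.
  by rewrite /= ger0_norm // mulr_ge0 ?pi_ge0 // exprn_ge0 // ltW // posP.
(* A3 starts at s = 1; the case s = 0 is the normalization in A1. *)
case: s => [|s].
  have -> : (\int[mu]_(a in posR) (a ^+ 0 * pi a)%:E = \int[mu]_(a in posR) (pi a)%:E)%E.
    by apply: eq_integral => a _; rewrite expr0 mul1r.
  by rewrite hA1.2.2 ltry.
case: hA3 => D [nu [rho [_ [_ [_ [_ H]]]]]].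
by apply: lt_trans (H s.+1 isT) _; rewrite ltry.
Qed.

(** Since rho >= 38, rho^-s <= 19^-s 2^-s, and 2^-s cancels the factor 2^s lost in [Gamma_le]. *)
Lemma moment_le : exists2 D, 0 < D &
  forall s, (0 < s)%N -> moment s <= D * (s`!%:R / 19 ^+ s).
Proof.
case: hA3 => D [nu [rho [D0 [nu0 [rho0 [rho38 H]]]]]].
have [C C0 HC] := Gamma_le (ltW nu0).
(* The added 1 keeps the constant positive when C = 0. *)
exists (D * C + 1) => [|s s0]; first by rewrite ltr_wpDl // mulr_ge0 // ltW.
have {}H := H s s0.
have h1 : moment s <= D * rho ^- s * Gamma (nu + s%:R + 1).
  rewrite /moment /Rintegral -lee_fin fineK ?ltW //.
  exact: integrable_fin_num (integrable_moment s).
apply: le_trans h1 _.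
have h2 : rho ^- s <= 38 ^- s.
  by rewrite lef_pV2 ?posrE ?exprn_gt0 // lerXn2r ?nnegrE // ltW.
apply: (@le_trans _ _ (D * 38 ^- s * (C * 2 ^+ s * s`!%:R))).
  apply: (@le_trans _ _ (D * rho ^- s * (C * 2 ^+ s * s`!%:R))).
    by rewrite ler_wpM2l // mulr_ge0 ?invr_ge0 ?exprn_ge0 // ltW.
  by rewrite ler_wpM2r ?mulr_ge0 ?exprn_ge0 // ler_wpM2l // ltW.
have -> : 38 ^- s = (19 ^+ s)^-1 * (2 ^+ s)^-1 :> R.
  by rewrite -!exprVn -exprMn; congr (_ ^+ _); field.
have -> : D * ((19 ^+ s)^-1 * (2 ^+ s)^-1) * (C * 2 ^+ s * s`!%:R) = D * C * (s`!%:R / 19 ^+ s).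
  by field; rewrite !expf_neq0.
by rewrite ler_wpM2r ?divr_ge0 ?exprn_ge0 // lerDl.
Qed.

Lemma integrable_dmoment m s :
  mu.-integrable posR (EFin \o (fun a => a ^+ s * damp m a * pi a)).
Proof.
apply: le_integrable (integrable_moment s) => //.
  apply/measurable_EFinP; apply: measurable_funM => //.
  by apply: measurable_funM; [exact: measurable_funX|exact: measurable_funTS (measurable_damp m)].
move=> a /[dup] ap /posP a0; rewrite lee_fin.
have as0 : 0 <= a ^+ s by rewrite exprn_ge0 // ltW.
have d0 : 0 <= damp m a by rewrite ltW // damp_gt0 // ltW.
rewrite !ger0_norm ?mulr_ge0 ?pi_ge0 //.
by rewrite ler_wpM2r ?pi_ge0 // ler_piMr // damp_le1 // ltW.
Qed.

Lemma dmoment_ge0 m s : 0 <= dmoment m s.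
Proof.
apply: Rintegral_ge0 => a /[dup] ap /posP a0; rewrite !mulr_ge0 ?pi_ge0 //.
  by rewrite exprn_ge0 // ltW.
by rewrite ltW // damp_gt0 // ltW.
Qed.

Lemma rising_dmoment m s :
  Rintegral mu posR (fun a => a ^+ s.+1 / rising a m.+1 * pi a) = (m`!%:R)^-1 * dmoment m s.
Proof.
rewrite /dmoment -RintegralZl //; last exact: integrable_dmoment.
apply: eq_Rintegral => a /set_mem /posP a0.
by rewrite rising_damp // [RHS]mulrCA -!mulrA; congr (_ * (_ * _)).
Qed.

(** Pointwise bound, split at eta: for a <= eta, a^s <= a <= eta; for a > eta, the damping factor is
    at most its value at eta. *)
Lemma dmoment_le m s (eta : R) : (0 < s)%N -> 0 < eta -> eta <= 1 ->
  dmoment m s <= eta * dmoment m 0 + damp m eta * moment s.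
Proof.
move=> s0 e0 e1.
have i1 := integrable_dmoment m 0; have i2 := integrable_moment s.
rewrite /dmoment /moment -!RintegralZl // -RintegralD //; last 2 first.
- exact: (iZ eta i1).
- exact: (iZ (damp m eta) i2).
apply: le_Rintegral => //.
- exact: integrable_dmoment.
- exact: (iD (iZ eta i1) (iZ (damp m eta) i2)).
move=> a /[dup] ap /posP a0; rewrite !mulrA -mulrDl ler_wpM2r ?pi_ge0 //.
have da : 0 < damp m a by rewrite damp_gt0 // ltW.
have de : 0 < damp m eta by rewrite damp_gt0 // ltW.
have as0 : 0 <= a ^+ s by rewrite exprn_ge0 // ltW.
have [ae|ae] := leP a eta.
  apply: ler_wpDr; first by rewrite mulr_ge0 // ltW.
  rewrite expr0 mulr1 (ler_wpM2r (ltW da)) //; apply: (le_trans _ ae).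
  rewrite -(prednK s0) exprS; apply: ler_piMr; first exact: ltW.
  by rewrite exprn_ile1 ?(ltW a0) // (le_trans ae).
apply: ler_wpDl; first by rewrite !mulr_ge0 // ltW.
by rewrite mulrC ler_wpM2r // damp_anti // ltW.
Qed.

(** By A2 the prior is bounded below on an interval ]h/2, h[ with h <= eta, where the damping factor
    is at least its value at eta. The constant p does not depend on m. *)
Lemma dmoment0_ge (eta : R) : 0 < eta ->
  exists2 p, 0 < p & forall m, damp m eta * p <= dmoment m 0.
Proof.
case: hA2 => eps [delta [beta [eps0 [delta0 H]]]] e0.
pose h := Num.min 1 (Num.min eps eta).
have h0 : 0 < h by rewrite !lt_min ltr01 eps0 e0.
have h1 : h <= 1 by rewrite ge_min lexx.
have heps : h <= eps by rewrite !ge_min lexx orbT.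
have heta : h <= eta by rewrite !ge_min lexx !orbT.
(* The absolute value treats both signs of beta at once: for h/2 < a <= 1, a^beta >= a^|beta| >=
   (h/2)^|beta|. *)
pose k := delta^-1 * (h / 2) `^ `|beta|.
have k0 : 0 < k by rewrite mulr_gt0 ?invr_gt0 // powR_gt0 // divr_gt0.
have pik a : h / 2 < a < h -> k <= pi a.
  move=> /andP[ha ah]; have a0 : 0 < a by apply: lt_trans ha; rewrite divr_gt0.
  have [//|+ _] := H a a0 _; first exact: lt_le_trans heps.
  apply: le_trans; rewrite ler_wpM2l ?invr_ge0 ?(ltW delta0) //.
  have a1 : a <= 1 by rewrite (le_trans (ltW ah)).
  apply: (@le_trans _ _ (a `^ `|beta|)).
    by rewrite ge0_ler_powR ?nnegrE ?divr_ge0 ?(ltW h0) ?(ltW a0) ?(ltW ha).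
  by rewrite ger_powR ?a0 // ler_norm.
exists (k * (h / 2)) => [|m]; first by rewrite mulr_gt0 // divr_gt0.
have d0 : 0 < damp m eta by rewrite damp_gt0 // ltW.
pose I : set R := `]h / 2, h[%classic.
have mI : measurable I by exact: measurable_itv.
have Ipos : I `<=` posR.
  move=> a; rewrite /I /Defs.posR /= !in_itv /= andbT => /andP[ha _].
  by apply: lt_trans ha; rewrite divr_gt0.
pose F (a : R) := (a ^+ 0 * damp m a * pi a)%:E.
have mF : measurable_fun posR F by case/integrableP: (integrable_dmoment m 0).
have F0 a : posR a -> (0 <= F a)%E.
  move=> /[dup] ap /posP a0; rewrite lee_fin !mulr_ge0 ?pi_ge0 //.
  by rewrite ltW // damp_gt0 // ltW.
suff : ((damp m eta * (k * (h / 2)))%:E <= \int[mu]_(a in posR) F a)%E.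
  rewrite /dmoment /Rintegral -lee_fin fineK //.
  exact: integrable_fin_num (integrable_dmoment m 0).
apply: (@le_trans _ _ (\int[mu]_(a in I) F a)%E); last exact: ge0_subset_integral.
have -> : (damp m eta * (k * (h / 2)))%:E =
    (\int[mu]_(a in I) (cst (damp m eta * k)%:E a))%E.
  rewrite integral_cst //= lebesgue_measure_itv /= lte_fin ifT; last by lra.
  by rewrite -EFinB -EFinM; congr (_%:E); field.
apply: ge0_le_integral => //.
- by move=> a _; rewrite lee_fin mulr_ge0 // ltW.
- exact: measurable_funS Ipos mF.
move=> a aI; have a0 := posP (Ipos a aI).
move: aI; rewrite /I /= in_itv /= => aI; rewrite lee_fin expr0 mul1r.
apply: ler_pM; rewrite ?(ltW d0) ?(ltW k0) ?pik //.
apply: damp_anti; first exact: ltW.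
by case/andP: aI => _ /ltW ah; exact: le_trans heta.
Qed.

End Prior.

(** * Posterior odds against a single block *)

(** For n observations, (n-1)!/n times this number bounds the mean of the sum over partitions into s
    + 1 blocks. *)
Definition block_weight (R : realType) (s : nat) : R :=
  4 ^+ s.+1 * s.+1%:R ^+ 3 / s.+1`!%:R.

Section BlockWeight.
Variable R : realType.
Local Notation g := (@block_weight R).

Lemma block_weight_ge0 s : 0 <= g s.
Proof. by rewrite divr_ge0 // mulr_ge0 // exprn_ge0. Qed.

Let succ_le_exp2 (s : nat) : s.+1%:R <= 2 ^+ s :> R.
Proof. by rewrite -natrX ler_nat ltn_expl. Qed.

(** From (s+1)^3 <= 8^s, each term is at most 4 (64^s / s!) 2^-s <= 4 e^64 2^-s. *)
Lemma sum_block_weight_le n : \sum_(1 <= s < n) g s <= 8 * expR 64.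
Proof.
apply: (@le_trans _ _ (\sum_(s < n) 4 * expR 64 * 2^-1 ^+ s)).
  apply: (@le_trans _ _ (\sum_(0 <= s < n) g s)).
    case: n => [|n]; first by rewrite !big_geq.
    by rewrite [leRHS]big_ltn // lerDr block_weight_ge0.
  rewrite big_mkord; apply: ler_sum => -[s _] _ /=.
  have h1 : s.+1%:R ^+ 3 <= 8 ^+ s :> R.
    have -> : 8 ^+ s = (2 ^+ s) ^+ 3 :> R by rewrite exprAC; congr (_ ^+ _); ring.
    by rewrite lerXn2r ?nnegrE ?exprn_ge0.
  have h2 : 64 ^+ s / s`!%:R <= expR 64 :> R by exact: expR_ge_term.
  apply: (@le_trans _ _ (4 * (64 ^+ s / s`!%:R) * 2^-1 ^+ s)); last first.
    by rewrite ler_wpM2r ?exprn_ge0 // ler_wpM2l.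
  apply: (@le_trans _ _ (4 ^+ s.+1 * 8 ^+ s / s`!%:R)).
    apply: ler_pM; rewrite ?invr_ge0 ?mulr_ge0 ?exprn_ge0 //; first by rewrite ler_wpM2l ?exprn_ge0.
    by rewrite lef_pV2 ?posrE ?ltr0n ?fact_gt0 // ler_nat factS leq_pmull.
  have -> : 64 ^+ s = 4 ^+ s * 8 ^+ s * 2 ^+ s :> R by rewrite -!exprMn; congr (_ ^+ _); ring.
  rewrite exprVn exprS le_eqVlt; apply/orP; left; apply/eqP; field.
  by rewrite expf_neq0 // pnatr_eq0 -lt0n fact_gt0.
rewrite -mulr_sumr (_ : 8 * _ = 4 * expR 64 * 2); last by ring.
rewrite ler_wpM2l ?mulr_ge0 ?expR_ge0 //.
have z0 : 0 <= 2^-1 :> R by lra.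
have z1 : 2^-1 < 1 :> R by lra.
apply: le_trans (sum_geometric_le n z0 z1) _.
by have -> : (1 - 2^-1)^-1 = 2 :> R by field.
Qed.

(** The factorials cancel and (s+1)^2 <= 4^s, so each term is at most 4 (16/19)^s. The threshold 38
    = 2 * 19 enters here, through 16 < 19. *)
Lemma sum_fact_block_weight_le n :
  \sum_(1 <= s < n) s`!%:R / 19 ^+ s * g s <= 76 / 3.
Proof.
apply: (@le_trans _ _ (\sum_(s < n) 4 * (16 / 19) ^+ s)).
  apply: (@le_trans _ _ (\sum_(0 <= s < n) s`!%:R / 19 ^+ s * g s)).
    case: n => [|n]; first by rewrite !big_geq.
    by rewrite [leRHS]big_ltn // lerDr mulr_ge0 ?block_weight_ge0 // divr_ge0 // exprn_ge0.
  rewrite big_mkord; apply: ler_sum => -[s _] _ /=.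
  have h1 : s.+1%:R ^+ 2 <= 4 ^+ s :> R.
    have -> : 4 ^+ s = (2 ^+ s) ^+ 2 :> R by rewrite exprAC; congr (_ ^+ _); ring.
    by rewrite lerXn2r ?nnegrE ?exprn_ge0.
  have -> : s`!%:R / 19 ^+ s * g s = 4 * (4 ^+ s * s.+1%:R ^+ 2) / 19 ^+ s.
    rewrite /block_weight factS natrM exprS.
    by field; rewrite expf_neq0 // nat1r !pnatr_eq0 /= -lt0n fact_gt0.
  have -> : 4 * (16 / 19) ^+ s = 4 * (4 ^+ s * 4 ^+ s) / 19 ^+ s :> R.
    by rewrite expr_div_n -exprMn mulrA; congr (_ * _ ^+ _ / _); ring.
  by rewrite ler_wpM2r ?invr_ge0 ?exprn_ge0 // ler_wpM2l // ler_wpM2l ?exprn_ge0.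
rewrite -mulr_sumr.
apply: (@le_trans _ _ (4 * (1 - 16 / 19)^-1)); last first.
  have -> : (1 - 16 / 19)^-1 = 19 / 3 :> R by field.
  by lra.
by rewrite ler_wpM2l // sum_geometric_le //; lra.
Qed.

Variable pi : R -> R.
Hypotheses (hA1 : A1 pi) (hA2 : A2 pi) (hA3 : A3_ge 38 pi).

(** Fixing eta first brings the part proportional to eta below half of the target. The other half is
    of order [damp m eta], negligible against [damp m (eta / 2)], which bounds [dmoment pi m 0] from
    below up to a constant. *)
Lemma dmoment_tail (t : R) : 0 < t -> exists N, forall m, (N <= m)%N ->
  0 < dmoment pi m 0 /\
  \sum_(1 <= s < m.+1) dmoment pi m s * g s <= t * dmoment pi m 0.
Proof.
move=> t0; pose C1 : R := 8 * expR 64; have C10 : 0 < C1 by rewrite mulr_gt0 // expR_gt0.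
have [D D0 HD] := moment_le hA1 hA3.
pose eta := Num.min 1 (t / 2 / C1).
have eta0 : 0 < eta by rewrite lt_min ltr01 !divr_gt0.
have eta1 : eta <= 1 by rewrite ge_min lexx.
have etat : eta * C1 <= t / 2 by rewrite -ler_pdivlMr // ge_min lexx orbT.
have e20 : 0 < eta / 2 by rewrite divr_gt0.
have [p p0 Hp] := dmoment0_ge hA1 hA2 hA3 e20.
(* Solves t/2 * (eta/3 * M) * p = D * 76/3, the balance needed once the harmonic sum exceeds M. *)
pose M := D * (76 / 3) / (eta / 3 * p * (t / 2)).
have [N HN] := harmonic_unbounded M.
exists N => m /HN; set Hm := \sum_(i < m) _ => MH.
have d0 : 0 < damp m (eta / 2) by rewrite damp_gt0 // ltW.
have de0 : 0 < damp m eta by rewrite damp_gt0 // ltW.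
have dm0 : 0 < dmoment pi m 0 by apply: lt_le_trans (Hp m); rewrite mulr_gt0.
split=> //.
have small : damp m eta * D * (76 / 3) <= t / 2 * dmoment pi m 0.
  apply: (@le_trans _ _ (t / 2 * (damp m (eta / 2) * p))); last first.
    by rewrite ler_wpM2l // divr_ge0 // ltW.
  apply: (@le_trans _ _ (t / 2 * (damp m eta * (eta / 3 * Hm) * p))); last first.
    rewrite ler_wpM2l ?divr_ge0 ?(ltW t0) // ler_wpM2r ?(ltW p0) //; exact: damp_ratio.
  have -> : damp m eta * D * (76 / 3) = t / 2 * (damp m eta * (eta / 3 * M) * p).
    by rewrite /M; field; rewrite !gt_eqF.
  by rewrite ler_wpM2l ?divr_ge0 ?(ltW t0) // ler_wpM2r ?(ltW p0) //
    ler_wpM2l ?(ltW de0) // ler_wpM2l ?divr_ge0 ?(ltW eta0).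
apply: (@le_trans _ _ (\sum_(1 <= s < m.+1)
   (eta * dmoment pi m 0 * g s + damp m eta * D * (s`!%:R / 19 ^+ s * g s)))).
  rewrite !big_nat; apply: ler_sum => s /andP[s0 _].
  have -> : eta * dmoment pi m 0 * g s + damp m eta * D * (s`!%:R / 19 ^+ s * g s) =
     (eta * dmoment pi m 0 + damp m eta * (D * (s`!%:R / 19 ^+ s))) * g s by ring.
  rewrite ler_wpM2r ?block_weight_ge0 //.
  apply: le_trans (dmoment_le hA1 hA3 m s0 eta0 eta1) _.
  by rewrite lerD2l ler_wpM2l ?(ltW de0) // HD.
rewrite big_split /= -!mulr_sumr.
have b1 := sum_block_weight_le m.+1; have b2 := sum_fact_block_weight_le m.+1.
apply: (@le_trans _ _ (eta * C1 * dmoment pi m 0 + damp m eta * D * (76 / 3))).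
  apply: lerD; last by rewrite ler_wpM2l // mulr_ge0 // ltW.
  by rewrite mulrAC ler_wpM2r ?(ltW dm0) // ler_wpM2l ?(ltW eta0).
have -> : t * dmoment pi m 0 = t / 2 * dmoment pi m 0 + t / 2 * dmoment pi m 0 by field.
by apply: lerD => //; rewrite ler_wpM2r // ltW.
Qed.
End BlockWeight.

(** * The posterior in terms of overlaps *)

Section Mixture.
Variables (R : realType) (ths c : R) (pi : R -> R).
Hypotheses (c0 : 0 < c) (hA1 : A1 pi) (hA3 : A3_ge 38 pi).

Definition overlap_sum n (x : 'I_n -> R) (s : nat) : R :=
  \sum_(Q in partitions_s n s)
     \prod_(A in Q) ((#|A|.-1)`!%:R * overlap ths c x A).

(** The block sizes add up to n, so the prefactor is the same for every s and cancels in [postK]. *)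
Lemma Wpost_unif m (x : 'I_m.+1 -> R) s :
  Wpost (unif_kernel c) (unif_dens ths c) pi x s.+1 =
  (2 * c)^-1 ^+ m.+1 / m`!%:R * (dmoment pi m s * overlap_sum x s.+1).
Proof.
rewrite /Wpost rising_dmoment //.
have -> : \sum_(Q in partitions_s m.+1 s.+1) \prod_(A in Q)
    ((#|A|.-1)`!%:R * marg (unif_kernel c) (unif_dens ths c) x A) =
    (2 * c)^-1 ^+ m.+1 * overlap_sum x s.+1.
  rewrite /overlap_sum mulr_sumr; apply: eq_bigr => Q; rewrite inE => /andP[pQ _].
  have -> : (2 * c)^-1 ^+ m.+1 = \prod_(A in Q) (2 * c)^-1 ^+ #|A|.
    rewrite prodrXr -(card_partition pQ).
    by rewrite cardsT card_ord.
  rewrite -big_split /=; apply: eq_bigr => A _.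
  by rewrite marg_unif // mulrCA.
ring.
Qed.

Lemma overlap_sum_ge0 n (x : 'I_n -> R) s : 0 <= overlap_sum x s.
Proof.
apply: sumr_ge0 => Q _; apply: prodr_ge0 => A _.
by rewrite mulr_ge0 // overlap_ge0.
Qed.

Lemma overlap_sum1 m (x : 'I_m.+1 -> R) :
  overlap_sum x 1 = m`!%:R * overlap ths c x [set: 'I_m.+1].
Proof.
rewrite /overlap_sum (big_pred1 [set [set: 'I_m.+1]]%SET).
  by rewrite big_set1 cardsT card_ord.
move=> Q; rewrite /= inE; apply/andP/eqP => [[pQ /cards1P[A QA]]|->].
  by move: (cover_partition pQ); rewrite QA /finset.cover big_set1 => ->.
rewrite cards1 eqxx; split => //; apply/and3P; split.
- by rewrite /finset.cover big_set1.
- by apply/finset.trivIsetP => A B; rewrite !inE => /eqP-> /eqP->; rewrite eqxx.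
- by rewrite inE eq_sym -cards_eq0 cardsT card_ord.
Qed.

(** The posterior probability of one block is L / (L + S), at distance S / (L + S) from 1. *)
Lemma postK1_dist m (x : 'I_m.+1 -> R) :
  let L := dmoment pi m 0 * overlap_sum x 1 in
  let S := \sum_(1 <= s < m.+1) dmoment pi m s * overlap_sum x s.+1 in
  0 < L -> `|postK (unif_kernel c) (unif_dens ths c) pi x 1 - 1| <= S / L.
Proof.
move=> L S L0.
set K := (2 * c)^-1 ^+ m.+1 / m`!%:R.
have K0 : 0 < K.
  by rewrite mulr_gt0 ?exprn_gt0 ?invr_gt0 ?mulr_gt0 // ltr0n fact_gt0.
have S0 : 0 <= S by apply: sumr_ge0 => s _; rewrite mulr_ge0 ?dmoment_ge0 ?overlap_sum_ge0.
have -> : postK (unif_kernel c) (unif_dens ths c) pi x 1 = L / (L + S).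
  rewrite /postK Wpost_unif -/K -/L big_add1 /= big_ltn //.
  under eq_bigr => s _ do rewrite Wpost_unif -/K.
  rewrite Wpost_unif -/K -/L -mulr_sumr -/S -mulrDr invfM mulrACA divff ?mul1r //.
  by rewrite gt_eqF.
have LS : 0 < L + S by rewrite ltr_pwDl.
have -> : L / (L + S) - 1 = - (S / (L + S)) by field; rewrite gt_eqF.
rewrite normrN ger0_norm ?divr_ge0 ?(ltW LS) //.
by rewrite ler_wpM2l // lef_pV2 ?posrE // lerDl.
Qed.

(** Since (a-1)!/(a+1) = a! p(a) with p(a) = 1/(a(a+1)), the exponential formula and the decay of
    the convolution powers apply. *)
Lemma sum_block_bound n s : (0 < n)%N ->
  \sum_(Q in partitions_s n s.+1)
     \prod_(A in Q) ((#|A|.-1)`!%:R * (4 / #|A|.+1%:R)) <=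
  (n.-1)`!%:R / n%:R * block_weight R s.
Proof.
move=> n0; set p := fun a : nat => (a * a.+1)%:R^-1 : R.
have -> : \sum_(Q in partitions_s n s.+1)
     \prod_(A in Q) ((#|A|.-1)`!%:R * (4 / #|A|.+1%:R)) =
   4 ^+ s.+1 * \sum_(Q in set_partitions [set: 'I_n] s.+1) \prod_(A in Q) ((#|A|)`!%:R * p #|A|).
  rewrite mulr_sumr; apply: eq_bigr => Q; rewrite inE => /andP[pQ /eqP cQ].
  rewrite -cQ -prodr_const -big_split /=; apply: eq_bigr => A AQ.
  have : (0 < #|A|)%N by rewrite card_gt0 (partition_neq0 pQ).
  case: #|A| => // a _; rewrite /p factS !natrM /=.
  by field; rewrite nat1r -natrD !pnatr_eq0.
rewrite sum_set_partitions cardsT card_ord.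
apply: (@le_trans _ _ (4 ^+ s.+1 * (n`!%:R / s.+1`!%:R * (s.+1%:R ^+ 3 / n%:R ^+ 2)))).
  by rewrite ler_wpM2l ?exprn_ge0 // ler_wpM2l ?divr_ge0 // conv_pow_pronic_le.
rewrite le_eqVlt; apply/orP; left; apply/eqP.
case: n n0 => // n _; rewrite /block_weight (factS n) natrM /=.
by field; rewrite nat1r !pnatr_eq0 /= -lt0n fact_gt0.
Qed.

End Mixture.

(** * Probability bounds and convergence *)

Section Posterior.
Variables (R : realType) (ths c : R) (pi : R -> R).
Hypotheses (c0 : 0 < c) (hA1 : A1 pi) (hA3 : A3_ge 38 pi).
Context d (Omega : measurableType d) (P : probability Omega R).
Variable X : nat -> Omega -> R.
Hypothesis hXm : forall i, measurable_fun setT (X i).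
Hypothesis hXind : mutually_independent P X.
Hypothesis hXunif : forall i (A : set R), measurable A ->
  P (X i @^-1` A) =
  (\int[@lebesgue_measure R]_(x in A) (uniform_pdf (ths - c) (ths + c) x)%:E)%E.

Let x n w := fun i : 'I_n => X i w.

(** A small overlap makes one of the two gaps less than r = c delta / n, which puts some X_i within
    r of an end; this is a union of 2n events of probability at most delta / (2n). *)
Lemma overlap_small_prob n (delta : R) : (0 < n)%N -> 0 < delta -> delta <= 1 ->
  (P [set w | (overlap ths c (@x n w) [set: 'I_n]%SET < delta / n%:R)%R] <= delta%:E)%E.
Proof.
move=> n0 d0 d1; have c1 := c0; have nR : 0 < n%:R :> R by rewrite ltr0n.
have half_lt (a b h : R) : a + b < 2 * h -> a < h \/ b < h.
  by move=> ab; have [?|?] := ltP a h; [left|right; lra].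
pose r := c * (delta / n%:R).
have r0 : 0 < r by rewrite mulr_gt0 // divr_gt0.
have rc : r <= c.
  by rewrite ler_piMr ?(ltW c1) // ler_pdivrMr // mul1r (le_trans d1) // ler1n.
pose T (b : bool) : set R := if b then `]ths + c - r, +oo[%classic else `]-oo, ths - c + r[%classic.
have mT b : measurable (T b) by case: b; exact: measurable_itv.
(* One index j < 2n codes an observation by j/2 and an end of the range by parity. *)
pose F j := X j./2 @^-1` T (odd j).
have mX i A : measurable A -> measurable (X i @^-1` A).
  by move=> mA; rewrite -[_ @^-1` _]setTI; exact: hXm.
have PF j : (P (F j) <= (delta / (2 * n%:R))%:E)%E.
  have -> : delta / (2 * n%:R) = r / (2 * c) by rewrite /r; field; rewrite !gt_eqF.
  rewrite /F; clearbody r; case: (odd j).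
    rewrite (_ : r / _ = ((ths + c) - (ths + c - r)) / (2 * c)); last by congr (_ / _); ring.
    apply: (@unif_prob_le _ ths c c0 _ _ P X hXunif) => //; first by lra.
    by move=> y; rewrite /= !in_itv /= andbT => -[? /andP[? ?]]; apply/andP; split; lra.
  rewrite (_ : r / _ = ((ths - c + r) - (ths - c)) / (2 * c)); last by congr (_ / _); ring.
  apply: (@unif_prob_le _ ths c c0 _ _ P X hXunif) => //; first by lra.
  by move=> y; rewrite /= !in_itv /= => -[? /andP[? ?]]; apply/andP; split; lra.
set small := [set w | _].
have msmall : measurable small.
  rewrite (_ : small = setT `&`
      (fun w => overlap ths c (@x n w) [set: 'I_n]%SET) @^-1` `]-oo, delta / n%:R[%classic).
    by apply: (measurable_overlap ths c hXm) => //; exact: measurable_itv.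
  by apply/seteqP; split => w; rewrite /small /= in_itv /= => // -[].
apply: (@le_trans _ _ (\sum_(j < 2 * n) P (F j))).
  apply: content_subadditive => //; first by move=> j _; exact: mX.
  move=> w; rewrite /small /= => lt.
  (* As r <= c, the initial value c of the minimum is not below r, so some i must be. *)
  have gapP (y : 'I_n -> R) : gap c y [set: 'I_n]%SET < r -> exists i, c - y i < r.
    move=> gr; apply/existsP; apply: contraLR gr; rewrite negb_exists -leNgt => /forallP H.
    by apply/bigmin_geP; split => // i _; rewrite leNgt.
  have [i [b Tb]] : exists i : 'I_n, exists b, T b (X i w).
    have sum_lt : gap c (fun i => x w i - ths) [set: 'I_n]%SET +
        gap c (fun i => ths - x w i) [set: 'I_n]%SET < 2 * r.
      move: lt; rewrite /overlap ltr_pdivrMr ?mulr_gt0 // gt_max => /andP[_].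
      by rewrite (_ : delta / n%:R * _ = 2 * r) // /r; ring.
    case: (half_lt _ _ _ sum_lt) => /gapP[i Hi]; exists i; [exists true|exists false].
      by rewrite /= in_itv /= andbT; move: Hi; rewrite /x; lra.
    by rewrite /= in_itv /=; move: Hi; rewrite /x; lra.
  rewrite -bigcup_mkord; exists (b + i.*2)%N; rewrite /F /=.
    by have := ltn_ord i; case: b {Tb} => /=; lia.
  by rewrite half_bit_double oddD odd_double addbF oddb.
apply: (@le_trans _ _ (\sum_(j < 2 * n) (delta / (2 * n%:R))%:E)%E).
  exact: lee_sum.
rewrite sumEFin lee_fin sumr_const card_ord -[leLHS]mulr_natl natrM.
by rewrite le_eqVlt; apply/orP; left; apply/eqP; field; rewrite gt_eqF.
Qed.

Lemma measurable_overlap_sum n s :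
  measurable_fun setT (fun w => overlap_sum ths c (@x n w) s).
Proof.
rewrite /overlap_sum; under eq_fun do rewrite big_mkcond.
apply: measurable_sum => Q; case: (Q \in _); last exact: measurable_cst.
apply: measurable_prod_cond => A; apply: measurable_funM => //.
exact: measurable_overlap.
Qed.

Lemma integral_overlap_sum_le n s : (0 < n)%N ->
  (\int[P]_w (overlap_sum ths c (@x n w) s.+1)%:E <=
    ((n.-1)`!%:R / n%:R * block_weight R s)%:E)%E.
Proof.
move=> n0; apply: (@le_trans _ _ (\sum_(Q in partitions_s n s.+1)
     \prod_(A in Q) ((#|A|.-1)`!%:R * (4 / #|A|.+1%:R)))%:E); last first.
  by rewrite lee_fin sum_block_bound.
rewrite /overlap_sum.
under eq_integral => w _ do rewrite -big_filter -sumEFin.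
rewrite ge0_integral_sum //; last 2 first.
- move=> Q; apply/measurable_EFinP; apply: measurable_prod_cond => A.
  by apply: measurable_funM => //; exact: measurable_overlap.
- by move=> Q w _; rewrite lee_fin prodr_ge0 // => A _; rewrite mulr_ge0 // overlap_ge0.
rewrite big_filter -sumEFin; apply: lee_sum => Q; rewrite inE => /andP[pQ _].
have -> : (\int[P]_w (\prod_(A in Q) ((#|A|.-1)`!%:R * overlap ths c (@x n w) A))%:E =
   \int[P]_w ((\prod_(A in Q) (#|A|.-1)`!%:R)%:E * (\prod_(A in Q) overlap ths c (@x n w) A)%:E))%E.
  by apply: eq_integral => w _; rewrite -EFinM -big_split.
rewrite ge0_integralZl_EFin //; last 3 first.
- by move=> w _; rewrite lee_fin prodr_ge0 // => A _; rewrite overlap_ge0.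
- by apply/measurable_EFinP; apply: measurable_prod_cond => A; exact: measurable_overlap.
- exact: prodr_ge0.
rewrite big_split EFinM; apply: lee_wpmul2l; first by rewrite lee_fin prodr_ge0.
exact: integral_prod_overlap_le.
Qed.

Lemma measurable_postK m :
  measurable_fun setT (fun w => postK (unif_kernel c) (unif_dens ths c) pi (@x m.+1 w) 1).
Proof.
have mW s : measurable_fun setT (fun w =>
    Wpost (unif_kernel c) (unif_dens ths c) pi (@x m.+1 w) s.+1).
  under eq_fun do rewrite Wpost_unif //.
  by do 2 apply: measurable_funM => //; exact: measurable_overlap_sum.
apply: measurable_funM => //.
apply: (measurableT_comp (@measurable_invr R)).
under eq_fun do rewrite big_add1 /=.
exact: measurable_sum.
Qed.

(** Off the event [E1] of a small overlap, the one-block term is bounded below, so a deviation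
    beyond eps forces S >= [lam], the event [E2]. Markov's inequality bounds [P E2]; the factors
    m!/(m+1) in the mean of S and in [lam] cancel. *)
Lemma postK_far_prob m (eps delta t : R) : 0 < eps -> 0 < delta -> delta <= 1 -> 0 < t ->
  0 < dmoment pi m 0 ->
  \sum_(1 <= s < m.+1) dmoment pi m s * block_weight R s <= t * dmoment pi m 0 ->
  (P [set w | (eps < `|postK (unif_kernel c) (unif_dens ths c) pi (@x m.+1 w) 1 - 1|)%R]
    <= (delta + t / (eps * delta))%:E)%E.
Proof.
move=> eps0 d0 d1 t0 dm0 tail.
pose S w := \sum_(1 <= s < m.+1) dmoment pi m s * overlap_sum ths c (@x m.+1 w) s.+1.
have mS : measurable_fun setT S.
  by apply: measurable_sum => s; apply: measurable_funM => //; exact: measurable_overlap_sum.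
have S0 w : 0 <= S w.
  by apply: sumr_ge0 => s _; rewrite mulr_ge0 ?dmoment_ge0 ?overlap_sum_ge0.
(* eps times the least value of the one-block term when the overlap is at least delta / (m+1). *)
pose lam := eps * (dmoment pi m 0 * (m`!%:R * (delta / m.+1%:R))).
have mf0 : 0 < m`!%:R :> R by rewrite ltr0n fact_gt0.
have lam0 : 0 < lam by rewrite !mulr_gt0 // divr_gt0.
pose E1 := [set w | overlap ths c (@x m.+1 w) [set: 'I_m.+1]%SET < delta / m.+1%:R].
pose E2 := [set w | lam <= S w].
have mE1 : measurable E1.
  rewrite (_ : E1 = setT `&`
      (fun w => overlap ths c (@x m.+1 w) [set: 'I_m.+1]%SET) @^-1` `]-oo, delta / m.+1%:R[%classic).
    by apply: (measurable_overlap ths c hXm) => //; exact: measurable_itv.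
  by apply/seteqP; split => w; rewrite /E1 /= in_itv /= => // -[].
have mE2 : measurable E2.
  rewrite (_ : E2 = setT `&` S @^-1` `[lam, +oo[%classic).
    by apply: mS => //; exact: measurable_itv.
  by apply/seteqP; split => w; rewrite /E2 /= in_itv /= andbT => // -[].
set bad := [set w | _].
have mbad : measurable bad.
  pose f w := `|postK (unif_kernel c) (unif_dens ths c) pi (@x m.+1 w) 1 - 1|.
  have mf : measurable_fun setT f.
    apply: measurableT_comp => //; apply: measurable_funB => //; exact: measurable_postK.
  rewrite (_ : bad = setT `&` f @^-1` `]eps, +oo[%classic).
    by apply: mf => //; exact: measurable_itv.
  by apply/seteqP; split => w; rewrite /bad /= in_itv /= andbT => // -[].
have sub : bad `<=` E1 `|` E2.
  move=> w; rewrite /bad /= => bw.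
  have [lt|ge] := ltP (overlap ths c (@x m.+1 w) [set: 'I_m.+1]%SET) (delta / m.+1%:R).
    by left.
  right; rewrite /E2 /=.
  have L0 : 0 < dmoment pi m 0 * overlap_sum ths c (@x m.+1 w) 1.
    rewrite overlap_sum1; apply: mulr_gt0 => //; apply: mulr_gt0 => //.
    by apply: lt_le_trans ge; rewrite divr_gt0.
  have := lt_le_trans bw (postK1_dist c0 hA1 hA3 L0).
  rewrite ltr_pdivlMr // => /ltW; apply: le_trans.
  by rewrite /lam overlap_sum1 ler_wpM2l ?(ltW eps0) // ler_wpM2l ?(ltW dm0) // ler_wpM2l ?(ltW mf0).
have PE2 : (P E2 <= (t / (eps * delta))%:E)%E.
  have intS : (\int[P]_w (S w)%:E <= (m`!%:R / m.+1%:R * (t * dmoment pi m 0))%:E)%E.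
    under eq_integral => w _ do rewrite -sumEFin.
    rewrite ge0_integral_sum //; last 2 first.
    - move=> s; apply/measurable_EFinP; apply: measurable_funM => //.
      exact: measurable_overlap_sum.
    - by move=> s w _; rewrite lee_fin mulr_ge0 ?dmoment_ge0 ?overlap_sum_ge0.
    apply: (@le_trans _ _ (\sum_(1 <= s < m.+1) (m`!%:R / m.+1%:R * (dmoment pi m s * block_weight R s)))%:E).
      rewrite -sumEFin; apply: lee_sum => s _.
      under eq_integral => w _ do rewrite EFinM.
      rewrite ge0_integralZl_EFin ?dmoment_ge0 //; last 2 first.
      - by move=> w _; rewrite lee_fin overlap_sum_ge0.
      - by apply/measurable_EFinP; exact: measurable_overlap_sum.
      rewrite mulrCA EFinM; apply: lee_wpmul2l; first by rewrite lee_fin dmoment_ge0.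
      exact: integral_overlap_sum_le.
    by rewrite lee_fin -mulr_sumr ler_wpM2l // divr_ge0.
  (* Markov's inequality for the nonnegative S. *)
  have mark : (lam%:E * P E2 <= \int[P]_w (S w)%:E)%E.
    apply: (@le_trans _ _ (\int[P]_(w in E2) (cst lam%:E w))%E).
      by rewrite integral_cst.
    apply: (@le_trans _ _ (\int[P]_(w in E2) (S w)%:E)%E).
      apply: ge0_le_integral => //.
      - by move=> w _; rewrite lee_fin ltW.
      - by apply/measurable_EFinP; exact: measurable_funTS.
    apply: ge0_subset_integral => //; first exact/measurable_EFinP.
    by move=> w _; rewrite lee_fin.
  have := le_trans mark intS.
  rewrite -(@fineK _ (P E2)) ?fin_num_measure // -EFinM !lee_fin -ler_pdivlMl // => /le_trans.
  apply; rewrite le_eqVlt; apply/orP; left; apply/eqP; rewrite /lam; field.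
  by rewrite !gt_eqF.
apply: (@le_trans _ _ (P (E1 `|` E2))).
  by apply: le_measure => //; rewrite inE //; exact: measurableU.
apply: le_trans (measureU2 _ mE1 mE2) _.
rewrite EFinD; apply: leeD => //.
exact: overlap_small_prob.
Qed.
End Posterior.

Theorem theorem2 (R : realType) (ths c : R) (hc : 0 < c) (pi : R -> R)
  (hA1 : A1 pi) (hA2 : A2 pi) (hA3 : A3_ge 38 pi)
  (d : measure_display) (Omega : measurableType d) (P : probability Omega R)
  (X : nat -> Omega -> R)
  (hXm : forall i, measurable_fun setT (X i))
  (hXind : mutually_independent P X)
  (hXunif : forall i (A : set R), measurable A ->
     P (X i @^-1` A) =
     (\int[@lebesgue_measure R]_(x in A) (uniform_pdf (ths - c) (ths + c) x)%:E)%E) :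
  forall eps : R, 0 < eps ->
    (fun n : nat =>
       P [set w | eps < `| postK (unif_kernel c) (unif_dens ths c) pi
                             (fun i : 'I_n => X i w) 1 - 1 |])
    @ \oo --> 0%E.
Proof.
move=> eps eps0; set f := fun n : nat => P _.
have small (e : R) : 0 < e -> \forall n \near \oo, (f n <= e%:E)%E.
  (* With t = eps * delta * (e/2), both delta and t / (eps * delta) are at most e/2. *)
  move=> e0; pose delta := Num.min 1 (e / 2).
  have d0 : 0 < delta by rewrite lt_min ltr01 divr_gt0.
  have d1 : delta <= 1 by rewrite ge_min lexx.
  have de : delta <= e / 2 by rewrite ge_min lexx orbT.
  have t0 : 0 < eps * delta * (e / 2) by rewrite !mulr_gt0 // divr_gt0.
  have [N HN] := dmoment_tail hA1 hA2 hA3 t0.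
  exists N.+1 => // -[//|m] /= Nm; have [dm0 tail] := HN m Nm.
  apply: le_trans (postK_far_prob hc hA1 hA3 hXm hXind hXunif eps0 d0 d1 t0 dm0 tail) _.
  rewrite lee_fin mulrAC divff ?mul1r; first by lra.
  by rewrite gt_eqF // mulr_gt0.
apply/fine_cvgP; split.
  apply: filterS (small 1 ltr01) => n fn.
  by rewrite ge0_fin_numE ?measure_ge0 // (le_lt_trans fn) // ltry.
apply/cvgrPdist_le => e e0; apply: filterS (small e e0) => n fn /=.
rewrite sub0r normrN ger0_norm; last by apply: fine_ge0; exact: measure_ge0.
rewrite -lee_fin fineK // ge0_fin_numE ?measure_ge0 //.
by rewrite (le_lt_trans fn) // ltry.
Qed.
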